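(* Let $\Omega\subset\mathbb{C}$ be a bounded domain whose boundary $\gamma=\partial\Omega$ is a rectifiable Jordan curve, positively oriented, let $f$ be analytic in a neighbourhood of $\overline{\Omega}$, let $w=w(z,\bar z)$ be a weight on $\Omega$, and let $W=W(z,\bar z)$ be a $\bar\partial$-antiderivative of $w$ (that is, $\partial W/\partial\bar z=w$) for which the complex Green identity \[ \iint_\Omega f(z)\,w(z,\bar z)\,dA=\frac{1}{2i}\oint_\gamma f(z)\,W(z,\bar z)\,dz \] holds. Let \[ \rho(z)=\sum_{z_k\in\Omega}\frac{c_k}{z-z_k}+\sum_{z_k\notin\Omega}\frac{d_k}{z-z_k}+p(z) \] be a rational approximant to $W$ on $\gamma$ (finite sums with complex coefficients $c_k,d_k$), where all poles $z_k$ are simple, no pole lies on $\gamma$, and $p$ is a polynomial. Set \[ \varepsilon=\max_{z\in\gamma}|\rho(z)-W(z,\bar z)|,\qquad I=\iint_\Omega f(z)\,w(z,\bar z)\,dA . \] Then the rule $I_n=\pi\sum_{z_k\in\Omega}c_k f(z_k)$ satisfies \[ |I-I_n|\le\tfrac12\,|\gamma|\,\varepsilon\,\max_{z\in\gamma}|f(z)|, \] where $|\gamma|$ is the length of $\gamma$.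
   Context: $dA$ denotes planar area (Lebesgue) measure on $\mathbb{C}\cong\mathbb{R}^2$, and $\partial/\partial\bar z=\tfrac12(\partial/\partial x+i\,\partial/\partial y)$. A function written $W(z,\bar z)$ or $w(z,\bar z)$ is simply a complex-valued function of the point $z$, not necessarily analytic. A $\bar\partial$-antiderivative $W$ of $w$ is a function with $\partial W/\partial\bar z=w$; it is understood to be single-valued on $\overline{\Omega}$ and smooth apart from integrable singularities. The poles $z_k$ are finitely many, pairwise distinct points; the first sum in $\rho$ runs over the poles in $\Omega$ and the second over the poles outside $\overline{\Omega}$. No quality of approximation of $W$ by $\rho$ is assumed beyond the definition of $\varepsilon$; the statement presupposes that the integrals and the maximum defining $I$ and $\varepsilon$ exist. *)

(* Defs.v *)
From HB Require Import structures.
From mathcomp Require Import all_boot all_order all_algebra.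
From mathcomp Require Import all_classical all_reals all_analysis.
From mathcomp Require Export complex.

Set Implicit Arguments.
Unset Strict Implicit.
Unset Printing Implicit Defensive.

Import Order.TTheory GRing.Theory Num.Theory.
Import numFieldNormedType.Exports.
Import Normc.

Local Open Scope classical_set_scope.
Local Open Scope ring_scope.

(* The complex plane: R[i] as a normed space over itself, so that [derivable]
   below is complex differentiability. The modulus with values in R is
   [normc]. *)
Notation "'CC[' R ]" := (R[i]^o) (format "'CC[' R ]") : type_scope.

Section PlaneSets.
Context {R : realType}.
Implicit Types (A Omega : set CC[R]) (f : CC[R] -> CC[R]).

Definition boundary A : set CC[R] := closure A `\` A°.

Definition bounded_domain Omega : Prop :=
  [/\ open Omega, connected Omega, Omega !=set0 & bounded_set Omega].

Definition analytic_near A f : Prop :=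
  exists U : set CC[R],
    [/\ open U, A `<=` U & forall z, U z -> derivable f z 1].

Definition is_max_on A (h : CC[R] -> R) (m : R) : Prop :=
  (exists2 z, A z & h z = m) /\ (forall z, A z -> h z <= m).

End PlaneSets.

Section Curves.
Context {R : realType}.
Implicit Types (g : R -> CC[R]) (h : CC[R] -> CC[R]) (s t : seq R).

Definition jordan_curve g : Prop :=
  [/\ {within `[0, 1]%classic, continuous g}, g 0 = g 1
    & {in `[0, 1[ &, injective g}].

Definition trace g : set CC[R] := g @` `[0, 1]%classic.

(* With [itv_partition 0 1 s], the points of the partition are 0 :: s. *)
Definition polygonal_length g s : R :=
  \sum_(i < size s) normc (g (nth 0 s i) - g (nth 0 (0 :: s) i)).

Definition polygonal_lengths g : set R :=
  [set polygonal_length g s | s in [set s | itv_partition 0 1 s]].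

Definition rectifiable g : Prop := has_ubound (polygonal_lengths g).

Definition curve_length g : R := sup (polygonal_lengths g).

Definition tagged_partition s t : Prop :=
  [/\ itv_partition 0 1 s, size t = size s
    & forall i, (i < size s)%N -> nth 0 (0 :: s) i <= nth 0 t i <= nth 0 s i].

Definition mesh_lt (delta : R) s : Prop :=
  forall i, (i < size s)%N -> nth 0 s i - nth 0 (0 :: s) i < delta.

Definition riemann_stieltjes_sum g h s t : CC[R] :=
  \sum_(i < size s)
    h (g (nth 0 t i)) * (g (nth 0 s i) - g (nth 0 (0 :: s) i)).

Definition is_contour_integral g h (J : CC[R]) : Prop :=
  forall e : R, 0 < e -> exists2 delta : R, 0 < delta &
    forall s t, tagged_partition s t -> mesh_lt delta s ->
      normc (riemann_stieltjes_sum g h s t - J) < e.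

Definition contour_integrable g h : Prop := exists J, is_contour_integral g h J.

(* Meaningful when [contour_integrable g h]; 0 otherwise. *)
Definition contour_integral g h : CC[R] :=
  xget 0 [set J | is_contour_integral g h J].

Definition winding_number g (a : CC[R]) : CC[R] :=
  (2 * pi%:C%C * 'i%C)^-1 * contour_integral g (fun z => (z - a)^-1).

Definition positively_oriented g (Omega : set CC[R]) : Prop :=
  forall a, Omega a -> winding_number g a = 1.

End Curves.

Section Area.
Context {R : realType}.
Implicit Types (A Omega S : set CC[R]) (h w W : CC[R] -> CC[R]).

Local Notation area := (@lebesgue_measure R \x @lebesgue_measure R)%E.

Definition of_plane (q : R * R) : CC[R] := (q.1 +i* q.2)%C.

Definition area_negligible A : Prop :=
  area.-negligible
    (of_plane @^-1` A).

Definition area_integrable A h : Prop :=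
  area.-integrable (of_plane @^-1` A)
    (fun q => (complex.Re (h (of_plane q)))%:E) /\
  area.-integrable (of_plane @^-1` A)
    (fun q => (complex.Im (h (of_plane q)))%:E).

Definition area_integral A h : CC[R] :=
  ((\int[area]_(q in of_plane @^-1` A)
      complex.Re (h (of_plane q)))
   +i*
   (\int[area]_(q in of_plane @^-1` A)
      complex.Im (h (of_plane q))))%C.

(* Derivative of h at z along v, with respect to a real parameter. *)
Definition real_derivable h (z v : CC[R]) : Prop :=
  derivable (fun t : R => complex.Re (h (z + t%:C%C * v))) 0 1 /\
  derivable (fun t : R => complex.Im (h (z + t%:C%C * v))) 0 1.

Definition real_derive h (v z : CC[R]) : CC[R] :=
  (derive1 (fun t : R => complex.Re (h (z + t%:C%C * v))) 0
   +i* derive1 (fun t : R => complex.Im (h (z + t%:C%C * v))) 0)%C.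

Definition partial_x h : CC[R] -> CC[R] := real_derive h 1.
Definition partial_y h : CC[R] -> CC[R] := real_derive h 'i%C.

Definition dbar h (z : CC[R]) : CC[R] :=
  2^-1 * (partial_x h z + 'i%C * partial_y h z).

Definition C1_on A h : Prop :=
  forall z, A z ->
    [/\ real_derivable h z 1, real_derivable h z 'i%C,
        {for z, continuous (partial_x h)} & {for z, continuous (partial_y h)}].

(* S is the set of singularities of W; since it is area-null, integrability of
   W off S is integrability of W on Omega. *)
Definition dbar_antiderivative Omega W w : Prop :=
  exists S : set CC[R],
    [/\ closed S, area_negligible S,
        {within closure Omega `\` S, continuous W},
        C1_on (Omega `\` S) W /\ (forall z, (Omega `\` S) z -> dbar W z = w z)
      & area_integrable (Omega `\` S) W].

End Area.

(* Main.v *)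
(* The rule I_n is exact for rho: by the residue theorem the contour integral of
   f rho is 2 pi i times the sum of the c_k f(z_k), so that I - I_n is 1/(2i)
   times the contour integral of f (W - rho), which is at most |gamma| eps max |f|.

   The residue theorem needs two ingredients.  First, the winding number of gamma
   is 0 about every b outside the closure of Omega.  If it were k, then
   (z - b) exp(-L) = (z - a)^k on gamma, for a in Omega and L a continuous function
   on gamma; extending L by Tietze's theorem and gluing with (z - a)^k outside
   Omega gives a nonvanishing continuous function on the plane, which has a
   continuous logarithm on every disc, so k = 0.  Second, Runge's theorem: by
   Goursat's lemma and Cauchy's formula on the squares of a grid, f is on the
   closure of Omega a uniform limit of sums of fractions alpha / (zeta - z) with
   zeta outside it; after partial fractions only winding numbers remain. *)

(* The curve is merely rectifiable: there is no derivative of [g] with which to pull integrals back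
   to [0,1], and no smoother contour inside [Omega] is built to deform it to. Integrals along [g]
   are therefore evaluated only for the fractions 1/(z - b), where the value is the increment of a
   continuous logarithm of [g - b]; every other integrand is reached by uniform approximation on the
   curve, whose cost is controlled by the length. This is why Runge's theorem stands where a
   deformation of contours would be expected. Orientation prescribes winding numbers inside [Omega]
   only, and the curve is tied to the exterior solely by [trace g = boundary Omega]; this forces the
   topological argument for outside points. Injectivity of [g] acts there: it turns a function of
   the parameter with equal end values into a function on the curve. Runge's theorem is applied
   twice: to [f], which yields Cauchy's formula at each inside pole, and to [f] times the rest of
   [rho], which is analytic near the closure once the finitely many outside poles are removed from
   the neighbourhood. *)
Require Import Defs.
From HB Require Import structures.
From mathcomp Require Import all_boot all_order all_algebra.
From mathcomp Require Import all_classical all_reals all_analysis.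
From mathcomp Require Import complex.
From mathcomp Require Import ring lra.
Import Order.TTheory GRing.Theory Num.Theory.
Import numFieldNormedType.Exports.
Import Normc.
Local Open Scope classical_set_scope.
Local Open Scope ring_scope.
Set Implicit Arguments.
Unset Strict Implicit.
Unset Printing Implicit Defensive.

(** * The modulus and the topology of the plane *)

Section ModulusTopology.
Context {R : realType}.
Implicit Types (x y z : R[i]) (e : R).

Lemma norm_normc z : `|z| = (normc z)%:C%C.
Proof. by rewrite normc_def; case: z. Qed.

Lemma normc_ge0 z : 0 <= normc z.
Proof. by case: z => a b; rewrite sqrtr_ge0. Qed.

Lemma normcB x y : normc (x - y) = normc (y - x).
Proof. by rewrite -normcN opprB. Qed.

Lemma normc_eq0 z : (normc z == 0) = (z == 0).
Proof. by apply/eqP/eqP => [/eq0_normc//|->]; exact: normc0. Qed.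

Lemma normc_gt0 z : (0 < normc z) = (z != 0).
Proof. by rewrite lt_neqAle normc_ge0 andbT eq_sym normc_eq0. Qed.

Lemma ler_normc_Re z : `|complex.Re z| <= normc z.
Proof.
case: z => a b /=; rewrite -sqrtr_sqr ler_wsqrtr// lerDl sqr_ge0//.
Qed.

Lemma ler_normc_Im z : `|complex.Im z| <= normc z.
Proof. by case: z => a b /=; rewrite -sqrtr_sqr ler_wsqrtr// lerDr sqr_ge0. Qed.

Lemma normc_real (a : R) : normc a%:C%C = `|a|.
Proof. by rewrite /= expr0n addr0 sqrtr_sqr. Qed.

Lemma normc_imag (a : R) : normc ('i%C * a%:C%C) = `|a|.
Proof. by rewrite normcM normc_real /= expr0n/= add0r expr1n sqrtr1 mul1r. Qed.

Lemma normc_le_ReIm z : normc z <= `|complex.Re z| + `|complex.Im z|.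
Proof.
rewrite {1}[z]complexE (le_trans (le_normcD _ _))//.
by rewrite normc_real normc_imag.
Qed.

Lemma ler_normc_dist x y z : normc (x - z) <= normc (x - y) + normc (y - z).
Proof. by rewrite (le_trans _ (le_normcD _ _))// addrA subrK. Qed.

Lemma lerB_normc x y : normc x - normc y <= normc (x - y).
Proof. by rewrite lerBlDr (le_trans _ (le_normcD _ _))// subrK. Qed.

Lemma ler_normc_sum (I : Type) (r : seq I) (P : pred I) (F : I -> R[i]) :
  normc (\sum_(i <- r | P i) F i) <= \sum_(i <- r | P i) normc (F i).
Proof.
elim/big_rec2: _ => [|i a b _ h]; first by rewrite normc0.
by rewrite (le_trans (le_normcD _ _))// lerD2l.
Qed.

(** The norm of [CC[R]] and its radii live in [R[i]]; a positive element there is real, so real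
    radii suffice. This bridge keeps all later epsilons in [R]. *)
Lemma nbhs_normcP (z : CC[R]) (P : set CC[R]) :
  nbhs z P <-> exists2 e, 0 < e & forall y, normc (y - z) < e -> P y.
Proof.
split.
  move/(@nbhs_normP R[i] CC[R]) => [e /= e0 h].
  have er : e = (complex.Re e)%:C%C by move: e0; case: e {h} => a b; rewrite ltcE /= =>
    /andP[/eqP -> _].
  exists (complex.Re e); first by rewrite -ltcR -er.
  by move=> y hy; apply: h; rewrite /ball_/= norm_normc er ltcR normcB.
move=> [e e0 h]; apply/(@nbhs_normP R[i] CC[R]); exists e%:C%C => /=.
  by rewrite ltcR.
by move=> y /=; rewrite norm_normc ltcR => hy; apply: h; rewrite normcB.
Qed.

Lemma cvg_normcP {T : Type} (F : set_system T) {FF : Filter F}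
    (h : T -> CC[R]) (l : CC[R]) :
  h t @[t --> F] --> l <-> (forall e, 0 < e -> \forall t \near F, normc (h t - l) < e).
Proof.
split=> [hl e e0|H A].
  by apply: (hl [set y | normc (y - l) < e]); apply/nbhs_normcP; exists e.
by move=> /nbhs_normcP[e e0 /= hA]; near=> t; apply: hA; near: t; exact: H.
Unshelve. all: by end_near. Qed.

Lemma cts_normcP (h : CC[R] -> CC[R]) (z : CC[R]) :
  {for z, continuous h} <-> (forall e, 0 < e -> exists2 d, 0 < d &
    forall y, normc (y - z) < d -> normc (h y - h z) < e).
Proof.
have P := @cvg_normcP _ (nbhs z) _ h (h z).
split=> [/P H e /H /nbhs_normcP//|H].
by apply/P => e /H ?; apply/nbhs_normcP.
Qed.

Lemma cts_real_normcP (h : CC[R] -> R) (z : CC[R]) :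
  {for z, continuous h} <-> (forall e, 0 < e -> exists2 d, 0 < d &
    forall y, normc (y - z) < d -> `|h y - h z| < e).
Proof.
have P := @cvgrPdist_lt _ _ _ (nbhs z) _ h (h z).
split=> [/P H e /H /nbhs_normcP[d d0 hd]|H].
  by exists d => // y /hd; rewrite distrC.
apply/P => e /H[d d0 hd]; apply/nbhs_normcP; exists d => // y /hd.
by rewrite distrC.
Qed.

Lemma Re_continuous : continuous (@complex.Re R : CC[R] -> R).
Proof.
move=> z; apply/cts_real_normcP => e e0; exists e => // y hy.
by apply: le_lt_trans hy; rewrite -raddfB ler_normc_Re.
Qed.

Lemma Im_continuous : continuous (@complex.Im R : CC[R] -> R).
Proof.
move=> z; apply/cts_real_normcP => e e0; exists e => // y hy.
by apply: le_lt_trans hy; rewrite -raddfB ler_normc_Im.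
Qed.

Lemma cvg_ReIm {T : Type} (F : set_system T) {FF : Filter F}
    (a b : T -> R) (la lb : R) :
  a t @[t --> F] --> la -> b t @[t --> F] --> lb ->
  (a t +i* b t)%C @[t --> F] --> ((la +i* lb)%C : CC[R]).
Proof.
move=> /cvgrPdist_lt ha /cvgrPdist_lt hb; apply/cvg_normcP => e e0.
have e2 : 0 < e / 2 by rewrite divr_gt0.
near=> t; rewrite (le_lt_trans (normc_le_ReIm _))//= (splitr e) ltrD//.
  by rewrite distrC; near: t; exact: ha.
by rewrite distrC; near: t; exact: hb.
Unshelve. all: by end_near. Qed.

(** Heine-Borel is transported from [R * R]: the set is closed in the continuous image of a compact
    square. *)
Lemma compact_closed_bounded (K : set CC[R]) :
  closed K -> (exists B : R, forall z, K z -> normc z <= B) -> compact K.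
Proof.
move=> cK [B hB].
pose S : set (R * R) := `[- B, B] `*` `[- B, B].
have cS : compact S by apply: compact_setX; exact: segment_compact.
have : compact ((of_plane : _ -> CC[R]) @` S).
  apply: continuous_compact cS; apply: continuous_subspaceT => -[a b].
  by apply: cvg_ReIm; [exact: cvg_fst | exact: cvg_snd].
move=> /subclosed_compact; apply => //.
move=> z Kz; exists (complex.Re z, complex.Im z); last by case: {Kz} z.
by split=> /=; rewrite in_itv/= -ler_norml (le_trans _ (hB _ Kz))//
  ?ler_normc_Re ?ler_normc_Im.
Qed.

(** The near-covering form of compactness, along the filter of positive numbers tending to 0, merges
    the local values of d. It serves below for uniform continuity, positive lower bounds,
    thickenings of compact sets and estimates uniform in a parameter. *)
Lemma compact_uniform (T : topologicalType) (K : set T) (P : R -> T -> Prop) :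
  compact K -> (forall d d' (t : T), d' <= d -> P d t -> P d' t) ->
  (forall t, K t -> exists2 d, 0 < d & \forall y \near t, P d y) ->
  exists2 d, 0 < d & forall t, K t -> P d t.
Proof.
move=> /compact_near_coveringP cK mono loc.
have := cK R 0^'+ (fun d t => 0 < d -> P d t) _.
case=> [x Kx|].
  have [d d0 hd] := loc x Kx.
  near=> y e => _ /=; apply: (mono d); last by near: y.
  by near: e; exact: nbhs_right_le.
move=> e /= e0 he; exists (e / 2); first by rewrite divr_gt0.
move=> x Kx; have e2 : 0 < e / 2 by rewrite divr_gt0.
apply: (he (e / 2)) => //=; rewrite sub0r normrN gtr0_norm//.
by rewrite ltr_pdivrMr// ltr_pMr// ltr1n.
Unshelve. all: by end_near. Qed.

End ModulusTopology.

(** * Exponential and logarithm *)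

Section ComplexExponential.
Context {R : realType}.
Implicit Types (z : CC[R]) (e : R).

Definition cexp (z : R[i]) : CC[R] :=
  ((expR (complex.Re z) * cos (complex.Im z))
   +i* (expR (complex.Re z) * sin (complex.Im z)))%C.

Lemma cexpD (x y : R[i]) : cexp (x + y) = cexp x * cexp y.
Proof.
case: x y => [a b] [c d]; rewrite /cexp/= expRD cosD sinD.
by apply/eqP; rewrite eq_complex /=; apply/andP; split; apply/eqP; ring.
Qed.

Lemma cexp0 : cexp 0 = 1.
Proof. by rewrite /cexp/= expR0 cos0 sin0 mulr0 mulr1. Qed.

Lemma cexp_neq0 z : cexp z != 0.
Proof.
apply/eqP => h; have := cexpD z (- z); rewrite h mul0r addrN cexp0.
by move/eqP; rewrite oner_eq0.
Qed.

Lemma cexpN z : cexp (- z) = (cexp z)^-1.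
Proof.
by apply: (mulfI (cexp_neq0 z)); rewrite -cexpD subrr cexp0 divff ?cexp_neq0.
Qed.

Lemma cexpB (x y : R[i]) : cexp (x - y) = cexp x / cexp y.
Proof. by rewrite cexpD cexpN. Qed.

Lemma cexpMn (x : R[i]) n : cexp (x *+ n) = cexp x ^+ n.
Proof. by elim: n => [|n IH]; rewrite ?cexp0// mulrSr exprSr cexpD IH. Qed.

Lemma cexp_sum (I : Type) (r : seq I) (F : I -> R[i]) :
  cexp (\sum_(i <- r) F i) = \prod_(i <- r) cexp (F i).
Proof. by apply: (big_morph cexp); [exact: cexpD|exact: cexp0]. Qed.

Lemma cexp_continuous : continuous (cexp : CC[R] -> CC[R]).
Proof.
move=> z; apply: (@cvg_ReIm _ _ (nbhs z)); apply: (@cvgM _ _ (nbhs z)).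
- by apply: continuous_comp; [exact: Re_continuous|exact: continuous_expR].
- by apply: continuous_comp; [exact: Im_continuous|exact: continuous_cos].
- by apply: continuous_comp; [exact: Re_continuous|exact: continuous_expR].
- by apply: continuous_comp; [exact: Im_continuous|exact: continuous_sin].
Qed.

Lemma normc_continuous : continuous (@normc R : CC[R] -> R).
Proof.
move=> z; apply/cts_real_normcP => e e0; exists e => // y hy.
apply: le_lt_trans hy; rewrite ler_norml lerB_normc andbT.
by rewrite normcB lerNl opprB lerB_normc.
Qed.

(** Differentiability without a quotient, so that h = 0 is allowed. The field is general because the
    lemma serves over both [R] and [R[i]]. *)
Lemma derivable_approx (K : numFieldType) (f : K^o -> K^o) (z : K^o) :
  derivable f z 1 -> forall e : K, 0 < e ->
  \forall h \near (0 : K^o), `|f (z + h) - f z - h * 'D_1 f z| <= e * `|h|.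
Proof.
move=> /derivableP [df _] e e0.
have /cvgrPdist_le/(_ e e0) : h^-1 *: (f (h *: 1 + z) - f z) @[h --> (0 : K^o)^']
   --> 'D_1 f z.
  exact: df.
rewrite near_withinE; apply: filterS => h hh.
have [->|h0] := eqVneq h 0; first by rewrite addr0 subrr mul0r subrr !normr0 mulr0.
have := hh h0; rewrite -(ler_pM2l (_ : 0 < `|h|)) ?normr_gt0// -normrM.
rewrite (addrC z) (_ : h + z = h *: (1 : K^o) + z); last by rewrite [_ *: _]mulr1.
set X := f _ - f z; rewrite -[h^-1 *: X]/(h^-1 * X) mulrBr mulrA mulfV// mul1r.
by rewrite distrC [`|h| * _]mulrC.
Qed.

Lemma is_derive_approx (f : R -> R) (z l : R) : is_derive z 1 f l ->
  forall e, 0 < e -> exists2 d, 0 < d &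
    forall h, `|h| < d -> `|f (z + h) - f z - h * l| <= e * `|h|.
Proof.
move=> df e e0; have dz : derivable f z 1 by apply: ex_derive.
have := derivable_approx dz e0; rewrite derive_val.
move=> /(@nbhs_normP R R^o)[d /= d0 hd]; exists d => // h hh.
by apply: hd; rewrite /= sub0r normrN.
Qed.

Lemma cexp_approx e : 0 < e -> exists2 d, 0 < d &
  forall z, normc z < d -> normc (cexp z - 1 - z) <= e * normc z.
Proof.
move=> e0.
(* The four error terms bounded below cost 1, 2, 4 and 1 times k |z|, hence the 8. *)
have [k [k0 k1 k8]] : exists k : R, [/\ 0 < k, k <= 1 & 8 * k <= e].
  exists (Num.min 1 (e / 8)); split; first by rewrite lt_min ltr01 divr_gt0.
    by rewrite ge_min lexx.
  by rewrite mulrC -ler_pdivlMr// ge_min lexx orbT.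
have [d1 d10 h1] := is_derive_approx (is_derive_expR 0) k0.
have [d2 d20 h2] := is_derive_approx (is_derive_cos 0) k0.
have [d3 d30 h3] := is_derive_approx (is_derive_sin 0) k0.
exists (Num.min k (Num.min d1 (Num.min d2 d3))); first by rewrite !lt_min k0 d10 d20.
case=> a b; rewrite !lt_min => /and4P[zk z1 z2 z3].
set z := (a +i* b)%C.
have ra : `|a| <= normc z := ler_normc_Re z.
have rb : `|b| <= normc z := ler_normc_Im z.
have := h1 a (le_lt_trans ra z1); have := h2 b (le_lt_trans rb z2).
have := h3 b (le_lt_trans rb z3).
rewrite !add0r expR0 cos0 sin0 oppr0 mulr0 !mulr1 !subr0 addr0 => hs hc he.
set E := expR a - 1 - a in he; set Q := cos b - 1 in hc; set S := sin b - b in hs.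
have := normc_ge0 z; move: zk ra rb; set N := normc z => zk ra rb n0.
have na : 0 <= `|a| by [].
have nb : 0 <= `|b| by [].
have ka : k * `|a| <= k * N by rewrite ler_pM2l.
have kb : k * `|b| <= k * N by rewrite ler_pM2l.
have kn : k * N <= 1 * N by rewrite ler_wpM2r.
have cb : `|cos b| <= 1 by rewrite ler_norml cos_geN1 cos_le1.
have sb : `|S + b| <= 2 * N by apply: le_trans (ler_normD _ _) _; lra.
have a1 : `|1 + a| <= 2.
  by apply: le_trans (ler_normD _ _) _; rewrite normr1; lra.
apply: le_trans (normc_le_ReIm _) _ => /=.
have -> : expR a * cos b - 1 - a = E * cos b + (1 + a) * Q by rewrite /E /Q; ring.
have -> : expR a * sin b - 0 - b = (E + a) * (S + b) + S by rewrite /E /S; ring.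
have t1 : `|E * cos b| <= k * N.
  rewrite normrM; apply: (@le_trans _ _ (`|E| * 1)); first by rewrite ler_wpM2l.
  by rewrite mulr1 (le_trans he).
have t2 : `|(1 + a) * Q| <= 2 * (k * N).
  by rewrite normrM; apply: ler_pM => //; exact: le_trans hc _.
have t4 : `|(E + a) * (S + b)| <= 4 * (k * N).
  have -> : 4 * (k * N) = (2 * k) * (2 * N) by ring.
  rewrite normrM; apply: ler_pM => //.
  by apply: le_trans (ler_normD _ _) _; lra.
have t5 : 8 * k * N <= e * N by rewrite ler_wpM2r.
have := ler_normD (E * cos b) ((1 + a) * Q).
have := ler_normD ((E + a) * (S + b)) S.
lra.
Qed.

End ComplexExponential.

(** * Continuous logarithms of nonvanishing functions *)

Section ComplexLogarithm.
Context {R : realType}.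
Implicit Types (f h G : CC[R] -> CC[R]) (z w : CC[R]) (e : R).

Lemma cts_cst (c : CC[R]) z : {for z, continuous (fun _ : CC[R] => c)}.
Proof. exact: cst_continuous. Qed.

Lemma ctsD f h z : {for z, continuous f} -> {for z, continuous h} ->
  {for z, continuous (fun y => f y + h y)}.
Proof. by move=> cf ch; exact: (@cvgD R[i] CC[R] _ (nbhs z) _ f h _ _ cf ch). Qed.

Lemma ctsN f z : {for z, continuous f} -> {for z, continuous (fun y => - f y)}.
Proof. by move=> cf; exact: (@cvgN R[i] CC[R] _ (nbhs z) _ f _ cf). Qed.

Lemma ctsM f h z : {for z, continuous f} -> {for z, continuous h} ->
  {for z, continuous (fun y => f y * h y)}.
Proof. by move=> cf ch; exact: (@cvgM R[i] _ (nbhs z) _ f h _ _ cf ch). Qed.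

Lemma ctsV f z : f z != 0 -> {for z, continuous f} ->
  {for z, continuous (fun y => (f y)^-1)}.
Proof. by move=> f0 cf; exact: (@cvgV R[i] _ (nbhs z) _ f _ f0 cf). Qed.

Lemma ctsX f z n : {for z, continuous f} -> {for z, continuous (fun y => f y ^+ n)}.
Proof.
move=> cf; elim: n => [|n IH].
  rewrite (_ : (fun y => _) = fun=> 1); last by apply/funext => y; rewrite expr0.
  exact: cts_cst.
rewrite (_ : (fun y => _) = fun y => f y * f y ^+ n).
  exact: (ctsM cf IH).
by apply/funext => y; rewrite exprS.
Qed.

Lemma cts_sum (I : Type) (r : seq I) (F : I -> CC[R] -> CC[R]) z :
  (forall i, {for z, continuous (F i)}) ->
  {for z, continuous (fun y => \sum_(i <- r) F i y)}.
Proof.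
move=> cF; elim: r => [|i r IH].
  rewrite (_ : (fun y => _) = fun=> 0); first exact: cts_cst.
  by apply/funext => y; rewrite big_nil.
rewrite (_ : (fun y => _) = fun y => F i y + \sum_(j <- r) F j y).
  exact: (ctsD (cF i) IH).
by apply/funext => y; rewrite big_cons.
Qed.

Lemma cts_comp f h z : {for z, continuous f} -> {for f z, continuous h} ->
  {for z, continuous (fun y => h (f y))}.
Proof. exact: continuous_comp. Qed.

Lemma cts_real_complex (a b : CC[R] -> R) z :
  {for z, continuous a} -> {for z, continuous b} ->
  {for z, continuous (fun y => (a y +i* b y)%C : CC[R])}.
Proof. by move=> ca cb; exact: (@cvg_ReIm _ _ (nbhs z) _ a b _ _ ca cb). Qed.

(** The principal branch on the half-plane Re w > 0, where the argument is this arctangent;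
    elsewhere the formula does not invert [cexp]. *)
Definition clog (w : R[i]) : CC[R] :=
  (ln (normc w) +i* atan (complex.Im w / complex.Re w))%C.

Lemma cexp_clog w : 0 < complex.Re w -> cexp (clog w) = w.
Proof.
case: w => a b /= a0; rewrite /cexp/=.
have n2 : 0 < a ^+ 2 + b ^+ 2 by rewrite ltr_pwDl ?exprn_gt0// sqr_ge0.
rewrite lnK ?posrE ?sqrtr_gt0//.
have c : Num.sqrt (a ^+ 2 + b ^+ 2) * cos (atan (b / a)) = a.
  rewrite cos_atan (_ : a ^+ 2 + b ^+ 2 = a ^+ 2 * (1 + (b / a) ^+ 2)); last first.
    by field; rewrite gt_eqF.
  rewrite sqrtrM ?sqr_ge0// sqrtr_sqr gtr0_norm// -mulrA divff ?mulr1//.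
  by rewrite sqrtr_eq0 -ltNge ltr_pwDl// sqr_ge0.
have s : sin (atan (b / a)) = b / a * cos (atan (b / a)).
  have c0 : cos (atan (b / a)) != 0.
    by apply/eqP => h; move: c; rewrite h mulr0 => /eqP; rewrite lt_eqF.
  by rewrite -[X in X * cos _]atanK /tan mulfVK.
by rewrite s mulrCA c mulfVK// gt_eqF.
Qed.

Lemma clog_continuous w : 0 < complex.Re w -> {for w, continuous (clog : CC[R] -> CC[R])}.
Proof.
move=> w0; apply: cts_real_complex.
  apply: (@continuous_comp _ _ _ (@normc R : CC[R] -> R)); first exact: normc_continuous.
  apply: continuous_ln; rewrite normc_gt0; apply: contraTneq w0 => ->.
  by rewrite ltxx.
apply: (@continuous_comp _ _ _ (fun w : CC[R] => complex.Im w / complex.Re w) atan).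
  apply: (@cvgM _ _ (nbhs w)); first exact: Im_continuous.
  by apply: (@cvgV _ _ (nbhs w)); [rewrite gt_eqF|exact: Re_continuous].
exact: continuous_atan.
Qed.

(** Multiplication by -1 = exp(i pi) or by i = exp(i pi/2), or by both, reduces w to the half-plane
    where [clog] inverts [cexp]. *)
Lemma cexp_surj w : w != 0 -> exists l, cexp l = w.
Proof.
have [|wle] := ltP 0 (complex.Re w); first by exists (clog w); rewrite cexp_clog.
have eN1 : cexp (0 +i* pi)%C = -1 :> R[i].
  by rewrite /cexp/= expR0 cospi sinpi mulr0 mul1r; apply/eqP; rewrite eq_complex /= oppr0
    !eqxx.
have eI : cexp (0 +i* (pi / 2))%C = 'i%C :> R[i].
  by rewrite /cexp/= expR0 cos_pihalf sin_pihalf mulr0 mul1r.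
move=> w0; have [wlt|wge] := ltP (complex.Re w) 0.
  exists (clog (- w) + (0 +i* pi)%C); rewrite cexpD cexp_clog ?eN1 ?mulrN1 ?opprK//.
  by rewrite raddfN /= oppr_gt0.
have {wle wge} wre : complex.Re w = 0 by apply/eqP; rewrite eq_le wle wge.
have wE : w = 'i%C * (complex.Im w)%:C%C by rewrite [LHS]complexE wre add0r.
have [wlt|wge|wi] := ltgtP (complex.Im w) 0; last by move: w0; rewrite wE wi mulr0 eqxx.
  exists (clog (- (complex.Im w)%:C%C) + ((0 +i* (pi / 2)) + (0 +i* pi))%C).
  rewrite !cexpD cexp_clog /= ?oppr_gt0// eI eN1 [RHS]wE.
  by rewrite mulrN1 mulrN mulNr opprK mulrC.
exists (clog ((complex.Im w)%:C%C) + (0 +i* (pi / 2))%C).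
by rewrite cexpD cexp_clog // eI [RHS]wE mulrC.
Qed.

(* The logarithm is built by radial scaling: G z is G 0 times the product of the
   ratios G((k+1)z/N)/G(kz/N), which for large N are so close to 1 that the
   principal logarithm applies to each of them. *)
Lemma continuous_logarithm G (B : R) : continuous G -> (forall z, G z != 0) ->
  exists L : CC[R] -> CC[R], forall z, normc z <= B ->
    {for z, continuous L} /\ cexp (L z) = G z.
Proof.
move=> cG G0; pose K : set CC[R] := [set z | normc z <= B].
have cK : compact K.
  apply: compact_closed_bounded; last by exists B.
  apply: (closed_comp (f := @normc R : CC[R] -> R) (D := [set x | x <= B])).
    by move=> z _; exact: normc_continuous.
  exact: closed_le.
(* An increment smaller than |G z| puts the ratio G y / G z within distance 1 of 1, hence in the
   right half-plane. *)
have [d d0 hd] : exists2 d : R, 0 < d & forall z, K z ->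
    forall y, normc (y - z) < d -> normc (G y - G z) < normc (G z).
  apply: (compact_uniform (P := fun d z => forall y, normc (y - z) < d ->
    normc (G y - G z) < normc (G z)) cK).
    by move=> d d' z dd h y hy; apply: h; exact: lt_le_trans hy dd.
  move=> z _; have m0 : 0 < normc (G z) by rewrite normc_gt0.
  (* With thirds, |G x - G y| < 2/3 |G z| < |G y| for x and y close to z, so the bound is relative
     to the moving point y. *)
  have m3 : 0 < normc (G z) / 3 by rewrite divr_gt0.
  have [d d0 hd] := (cts_normcP G z).1 (cG z) _ m3.
  exists (d / 2); first by rewrite divr_gt0.
  apply/nbhs_normcP; exists (d / 2); first by rewrite divr_gt0.
  move=> y hy x hx; have h1 := hd y (lt_le_trans hy _).
  have h2 : normc (G x - G z) < normc (G z) / 3.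
    apply: hd; apply: le_lt_trans (ler_normc_dist _ y _) _.
    by rewrite [d]splitr ltrD.
  have := ler_normc_dist (G x) (G z) (G y); have := lerB_normc (G z) (G y).
  rewrite (normcB (G z) (G y)); have : normc (G y - G z) < normc (G z) / 3.
    by apply: h1; rewrite ler_pdivrMr// ler_pMr// ler1n.
  lra.
(* With this [N], consecutive points kz/N and (k+1)z/N are less than d apart on the whole disc. *)
pose N := (Num.truncn (`|B| / d)).+1.
have N0 : (0 : R) < N%:R by rewrite ltr0n.
have hN : `|B| / d < N%:R by rewrite truncnS_gt.
pose q k (z : CC[R]) : CC[R] := (k%:R / N%:R)%:C%C * z.
pose r k z : CC[R] := G (q k.+1 z) / G (q k z).
have qK k z : K z -> (k <= N)%N -> K (q k z).
  rewrite /K/= /q => Kz kN; rewrite normcM normc_real ger0_norm ?divr_ge0//.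
  apply: le_trans Kz; rewrite ler_piMl ?normc_ge0// ler_pdivrMr// mul1r ler_nat//.
have rpos k z : K z -> (k < N)%N -> 0 < complex.Re (r k z).
  move=> Kz kN; have : normc (r k z - 1) < 1.
    rewrite /r -[X in _ - X](divff (G0 (q k z))) -mulrBl normcM normcV.
    rewrite ltr_pdivrMr ?normc_gt0// mul1r; apply: hd; first by apply: qK => //; exact: ltnW.
    rewrite /q -mulrBl -raddfB /= -mulrBl -natrB// subSnn normcM normc_real.
    rewrite ger0_norm ?divr_ge0// div1r mulrC ltr_pdivrMr// mulrC -ltr_pdivrMr//.
    apply: le_lt_trans hN; rewrite ler_pM2r ?invr_gt0//.
    exact: le_trans Kz (ler_norm _).
  move=> /(le_lt_trans (ler_normc_Re _)); rewrite raddfB /= ltr_norml => /andP[].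
  by rewrite ltrBrDr addNr.
have qc k : continuous (q k).
  by move=> z; apply: (ctsM (f := fun=> _) (h := id)); [exact: cts_cst|exact: cvg_id].
have rc k : continuous (r k).
  move=> z; apply: (ctsM (f := fun z => G (q k.+1 z)) (h := fun z => (G (q k z))^-1)).
    by apply: cts_comp; [exact: qc|exact: cG].
  by apply: ctsV => //; apply: cts_comp; [exact: qc|exact: cG].
have [l0 hl0] := cexp_surj (G0 0).
exists (fun z => l0 + \sum_(k < N) clog (r k z)) => z Kz; split.
  apply: ctsD; first exact: cts_cst.
  apply: cts_sum => k; apply: cts_comp; first exact: rc.
  by apply: clog_continuous; apply: rpos.
rewrite cexpD hl0 cexp_sum (eq_bigr (fun k : 'I_N => r k z)); last first.
  by move=> k _; rewrite cexp_clog//; exact: rpos.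
rewrite -(big_mkord xpredT (fun k => r k z)) /r telescope_prodf//.
by rewrite {2}/q mul0r mul0r mulrCA divff// mulr1 /q divff ?mul1r// gt_eqF.
Qed.

End ComplexLogarithm.

(** * Contour integrals *)

Section ContourIntegral.
Context {R : realType}.
Implicit Types (g : R -> CC[R]) (h : CC[R] -> CC[R]) (s t : seq R) (e : R).

Lemma tagged_partition_node s t i : tagged_partition s t ->
  (i <= size s)%N -> 0 <= nth 0 (0 :: s) i <= 1.
Proof.
move=> [ps _ _] si; rewrite (set_nth_default 1) ?ltnS//.
rewrite (itv_partition_nth_le _ ps) ?ltnS// andbT.
by rewrite (itv_partition_nth_ge _ ps) ?ltnS.
Qed.

Lemma tagged_partition_tag s t i : tagged_partition s t ->
  (i < size s)%N -> 0 <= nth 0 t i <= 1.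
Proof.
move=> p si; have [_ _ /(_ i si)/andP[h1 h2]] := p.
have /andP[h3 _] := tagged_partition_node p (ltnW si).
have /andP[_ h4] := tagged_partition_node p si.
by rewrite (le_trans h3 h1) (le_trans h2).
Qed.

(** This keeps [is_contour_integral] from being vacuous; uniqueness of the integral and the length
    estimate for it both start from such a partition. *)
Lemma tagged_partition_exists (d : R) : 0 < d ->
  exists s t, tagged_partition s t /\ mesh_lt d s.
Proof.
move=> d0; pose N := (Num.truncn d^-1).+1.
have N0 : (0 : R) < N%:R by rewrite ltr0n.
(* The node 0 is not listed in [s], so the entry of index i is (i+1)/N. *)
pose s : seq R := [seq i.+1%:R / N%:R | i <- iota 0 N].
have ss : size s = N by rewrite size_map size_iota.
have sn i : (i < N)%N -> nth 0 s i = i.+1%:R / N%:R.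
  by move=> iN; rewrite (nth_map 0%N) ?size_iota// nth_iota.
have sn0 i : (i < N)%N -> nth 0 (0 :: s) i = i%:R / N%:R.
  by case: i => [|i] iN /=; rewrite ?mul0r// sn// ltnW.
have st i : (i < N)%N -> nth 0 (0 :: s) i < nth 0 s i.
  by move=> iN; rewrite sn// sn0// ltr_pM2r ?invr_gt0// ltr_nat.
exists s, s; split; last first.
  move=> i; rewrite ss => iN; rewrite sn// sn0// -mulrBl -natrB// subSnn div1r.
  by rewrite -[d]invrK ltf_pV2 ?posrE ?invr_gt0// truncnS_gt.
split => //; last first.
  by move=> i; rewrite ss => iN; rewrite lexx andbT ltW// st.
split; first by apply/(pathP 0) => i; rewrite ss; exact: st.
rewrite (last_nth 0) ss -[nth _ _ _]/(nth 0 s N.-1) sn ?leqnn//.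
by rewrite prednK// divff// gt_eqF.
Qed.

Lemma is_contour_integral_unique g h (J K : CC[R]) :
  is_contour_integral g h J -> is_contour_integral g h K -> J = K.
Proof.
move=> hJ hK; apply/eqP; rewrite -subr_eq0 -normc_eq0; apply/negPn/negP => n0.
have e0 : 0 < normc (J - K) / 2 by rewrite divr_gt0// lt_neqAle eq_sym n0 normc_ge0.
have [d1 d10 h1] := hJ _ e0; have [d2 d20 h2] := hK _ e0.
have [s [t [p m]]] : exists s t, tagged_partition s t /\ mesh_lt (Num.min d1 d2) s.
  by apply: tagged_partition_exists; rewrite lt_min d10.
have m1 : mesh_lt d1 s by move=> i /m; rewrite lt_min => /andP[].
have m2 : mesh_lt d2 s by move=> i /m; rewrite lt_min => /andP[].
have := ler_normc_dist J (riemann_stieltjes_sum g h s t) K.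
rewrite (normcB J (riemann_stieltjes_sum _ _ _ _)); have := h1 _ _ p m1; have := h2 _ _ p m2;
  lra.
Qed.

Lemma contour_integral_val g h J :
  is_contour_integral g h J -> contour_integral g h = J.
Proof. by move=> hJ; apply: xget_unique => // K /is_contour_integral_unique; apply. Qed.

Lemma is_contour_integralD g h1 h2 J1 J2 :
  is_contour_integral g h1 J1 -> is_contour_integral g h2 J2 ->
  is_contour_integral g (fun z => h1 z + h2 z) (J1 + J2).
Proof.
move=> i1 i2 e e0; have e2 : 0 < e / 2 by rewrite divr_gt0.
have [d1 d10 H1] := i1 _ e2; have [d2 d20 H2] := i2 _ e2.
exists (Num.min d1 d2) => [|s t p m]; first by rewrite lt_min d10.
have m1 : mesh_lt d1 s by move=> i /m; rewrite lt_min => /andP[].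
have m2 : mesh_lt d2 s by move=> i /m; rewrite lt_min => /andP[].
rewrite (_ : riemann_stieltjes_sum _ _ _ _ - _ = (riemann_stieltjes_sum g h1 s t - J1)
  + (riemann_stieltjes_sum g h2 s t - J2)).
  by rewrite (splitr e) (le_lt_trans (le_normcD _ _))// ltrD// ?H1 ?H2.
rewrite /riemann_stieltjes_sum addrACA -opprD; congr (_ - _).
by rewrite -big_split; apply: eq_bigr => i _; rewrite mulrDl.
Qed.

Lemma is_contour_integralZ g h J (c : CC[R]) :
  is_contour_integral g h J -> is_contour_integral g (fun z => c * h z) (c * J).
Proof.
move=> ih e e0; have c1 : 0 < normc c + 1 by rewrite ltr_wpDl ?normc_ge0.
have [d d0 H] := ih _ (divr_gt0 e0 c1).
exists d => // s t p m.
rewrite (_ : riemann_stieltjes_sum _ _ _ _ - _ =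
  c * (riemann_stieltjes_sum g h s t - J)).
  have := H _ _ p m; rewrite normcM ltr_pdivlMr// mulrDr mulr1 mulrC.
  by apply: le_lt_trans; rewrite lerDl normc_ge0.
rewrite mulrBr /riemann_stieltjes_sum mulr_sumr; congr (_ - _).
by apply: eq_bigr => i _; rewrite mulrA.
Qed.

Lemma is_contour_integral0 g : is_contour_integral g (fun=> 0) 0.
Proof.
move=> e e0; exists 1 => // s t _ _; rewrite subr0.
by rewrite /riemann_stieltjes_sum big1 ?normc0// => i _; rewrite mul0r.
Qed.

Lemma is_contour_integral_sum g (I : Type) (r : seq I) (H : I -> CC[R] -> CC[R]) J :
  (forall i, is_contour_integral g (H i) (J i)) ->
  is_contour_integral g (fun z => \sum_(i <- r) H i z) (\sum_(i <- r) J i).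
Proof.
move=> hH; elim: r => [|i r IH].
  rewrite big_nil (_ : (fun z => _) = fun=> 0); first exact: is_contour_integral0.
  by apply/funext => z; rewrite big_nil.
rewrite big_cons (_ : (fun z => _) = fun z => H i z + \sum_(j <- r) H j z).
  exact: is_contour_integralD.
by apply/funext => z; rewrite big_cons.
Qed.

Lemma polygonal_length_le g s : rectifiable g -> itv_partition 0 1 s ->
  polygonal_length g s <= curve_length g.
Proof. by move=> rg ps; apply: ub_le_sup => //; exists s. Qed.

Lemma curve_length_ge0 g : rectifiable g -> 0 <= curve_length g.
Proof.
move=> rg; apply: le_trans (polygonal_length_le rg (itv_partition1 _)) => //.
by apply: sumr_ge0 => i _; exact: normc_ge0.
Qed.

Lemma riemann_stieltjes_sum_le g h s t (B : R) : rectifiable g ->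
  tagged_partition s t -> (forall z, trace g z -> normc (h z) <= B) ->
  normc (riemann_stieltjes_sum g h s t) <= B * curve_length g.
Proof.
move=> rg p hB; have [ps _ _] := p.
have gt x : 0 <= x <= 1 -> trace g (g x) by move=> hx; exists x => //=; rewrite in_itv.
have B0 : 0 <= B.
  by apply: le_trans (hB (g 0) (gt _ _)); rewrite ?normc_ge0// lexx ler01.
apply: (@le_trans _ _ (B * polygonal_length g s)); last first.
  by rewrite ler_wpM2l// polygonal_length_le.
apply: le_trans (ler_normc_sum _ _ _) _; rewrite /polygonal_length mulr_sumr.
apply: ler_sum => i _; rewrite normcM ler_wpM2r ?normc_ge0//.
by apply/hB/gt; apply: tagged_partition_tag p _.
Qed.

(** The error is measured by the chord |exp u - exp v| rather than by |u - v|: chords of the curve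
    add up to a polygonal length, whereas the variation of its logarithm is not known to be bounded
    beforehand. *)
Lemma cexp_secant e : 0 < e -> exists2 d, 0 < d & forall u v : R[i],
  normc u < d -> normc v < d ->
  normc (cexp u - cexp v - (u - v)) <= e * normc (cexp u - cexp v).
Proof.
move=> e0.
(* The error is at most 4k |u - v|. Since 4k <= 1/2, |u - v| is at most twice the chord, and the
   total 8k is below e. *)
have [k [k0 k1 ke]] : exists k : R, [/\ 0 < k, k <= 1 / 10 & 10 * k <= e].
  exists (Num.min (1 / 10) (e / 10)); split; first by rewrite lt_min !divr_gt0.
    by rewrite ge_min lexx.
  by rewrite mulrC -ler_pdivlMr// ge_min lexx orbT.
have [d d0 hd] := cexp_approx k0.
exists (Num.min (d / 2) k); first by rewrite lt_min k0 divr_gt0.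
move=> u v; rewrite !lt_min => /andP[u1 u2] /andP[v1 v2].
have uv : normc (u - v) < d.
  by apply: le_lt_trans (le_normcD _ _) _; rewrite normcN [d]splitr ltrD.
have hv : normc v < d by apply: lt_trans v1 _; rewrite ltr_pdivrMr// ltr_pMr// ltr1n.
have h1 := hd _ uv; have h2 := hd _ hv.
set th := u - v in uv h1 *.
have -> : cexp u - cexp v - th =
    cexp v * (cexp th - 1 - th) + (cexp v - 1) * th.
  have -> : cexp u = cexp v * cexp th by rewrite -cexpD /th addrCA subrr addr0.
  ring.
have b1 : normc (cexp v - 1) <= 2 * k.
  have := le_normcD (cexp v - 1 - v) v; rewrite subrK => /le_trans; apply.
  have := normc_ge0 v; nra.
have b2 : normc (cexp v) <= 2.
  have := le_normcD (cexp v - 1) 1; rewrite subrK normc1 => /le_trans; apply; lra.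
have b3 : normc (cexp v * (cexp th - 1 - th) + (cexp v - 1) * th) <= 4 * k * normc th.
  apply: le_trans (le_normcD _ _) _; rewrite !normcM.
  have := ler_pM (normc_ge0 _) (normc_ge0 _) b2 h1.
  have := ler_wpM2r (normc_ge0 th) b1; lra.
apply: (le_trans b3).
have b4 : normc th <= 2 * normc (cexp u - cexp v).
  have := lerB_normc th (cexp u - cexp v); rewrite (normcB th).
  have -> : cexp u - cexp v - th =
      cexp v * (cexp th - 1 - th) + (cexp v - 1) * th.
    have -> : cexp u = cexp v * cexp th by rewrite -cexpD /th addrCA subrr addr0.
    ring.
  have : 4 * k * normc th <= 1 / 2 * normc th.
    by rewrite ler_wpM2r ?normc_ge0//; lra.
  lra.
have n0 := normc_ge0 (cexp u - cexp v).
apply: (@le_trans _ _ (4 * k * (2 * normc (cexp u - cexp v)))).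
  by rewrite ler_wpM2l//; lra.
by rewrite mulrA ler_wpM2r//; lra.
Qed.

(* With u and v the increments of L from the tag to the ends of a subinterval, the
   term of the Riemann-Stieltjes sum is cexp u - cexp v, and that of L is u - v. *)
Lemma contour_integral_log g (b : CC[R]) (L : R -> R[i]) (m : R) : rectifiable g ->
  (forall e, 0 < e -> exists2 d, 0 < d & forall x y, 0 <= x <= 1 -> 0 <= y <= 1 ->
     `|x - y| < d -> normc (L x - L y) < e) ->
  (forall x, 0 <= x <= 1 -> cexp (L x) = g x - b) ->
  0 < m -> (forall x, 0 <= x <= 1 -> m <= normc (g x - b)) ->
  is_contour_integral g (fun z => (z - b)^-1) (L 1 - L 0).
Proof.
move=> rg cL eL m0 gm e e0.
have l0 := curve_length_ge0 rg; have l1 : 0 < curve_length g + 1 by lra.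
(* Each term is off by at most k/m times its chord, so the sum is off by at most e l/(l + 1) < e,
   where l is the length. *)
have k0 : 0 < e * m / (curve_length g + 1) by rewrite divr_gt0// mulr_gt0.
set k := e * m / (curve_length g + 1) in k0.
have [c c0 hc] := cexp_secant k0; have [d d0 hd] := cL _ c0.
exists d => // s t p ms; have [ps ts tt] := p.
have -> : L 1 - L 0 = \sum_(i < size s) (L (nth 0 s i) - L (nth 0 (0 :: s) i)).
  rewrite -(big_mkord xpredT (fun i => L (nth 0 (0 :: s) i.+1) - L (nth 0 (0 :: s) i))).
  by rewrite telescope_sumr// (itv_partition_nth_size _ ps).
rewrite /riemann_stieltjes_sum -sumrB.
apply: (@le_lt_trans _ _ (k / m * polygonal_length g s)); last first.
  apply: (@le_lt_trans _ _ (k / m * curve_length g)).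
    apply: ler_wpM2l; last exact: polygonal_length_le.
    by rewrite divr_ge0// ltW.
  have -> : k / m * curve_length g = e * (curve_length g / (curve_length g + 1)).
    by rewrite /k; field; rewrite !gt_eqF.
  by rewrite gtr_pMr// ltr_pdivrMr// mul1r ltrDl.
apply: le_trans (ler_normc_sum _ _ _) _; rewrite /polygonal_length mulr_sumr.
apply: ler_sum => i _.
have hi := tagged_partition_node p (ltn_ord i).
have hj := tagged_partition_node p (ltnW (ltn_ord i)).
have ht := tagged_partition_tag p (ltn_ord i).
rewrite [nth 0 (0 :: s) i.+1]/(nth 0 s i) in hi.
have /andP[t1 t2] := tt i (ltn_ord i); have := ms i (ltn_ord i).
move: t1 t2 hi hj ht.
set x := nth 0 s i; set y := nth 0 (0 :: s) i; set r := nth 0 t i => t1 t2 hi hj ht xy.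
have ub : normc (L x - L r) < c by apply: hd => //; rewrite ger0_norm; lra.
have vb : normc (L y - L r) < c by apply: hd => //; rewrite ler0_norm; lra.
have := hc _ _ ub vb.
have -> : L x - L r - (L y - L r) = L x - L y by ring.
have -> : cexp (L x - L r) - cexp (L y - L r) = (g r - b)^-1 * (g x - g y).
  by rewrite !cexpB !eL//; ring.
move=> /le_trans; apply; rewrite -mulrA ler_pM2l// normcM ler_wpM2r ?normc_ge0//.
by rewrite normcV lef_pV2 ?posrE ?gm// (lt_le_trans m0)// gm.
Qed.

End ContourIntegral.

(** * Winding numbers *)

Section Winding.
Context {R : realType}.
Implicit Types (g : R -> CC[R]) (a b z : CC[R]) (e t : R).

(** The retraction of the line onto [0,1]; composition with it trades continuity within [0,1] for
    continuity on [R]. *)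
Definition clamp t : R := Num.max 0 (Num.min 1 t).

Lemma clamp_itv t : 0 <= clamp t <= 1.
Proof. by rewrite /clamp le_max lexx ge_max ler01 ge_min lexx. Qed.

Lemma clamp_id t : 0 <= t <= 1 -> clamp t = t.
Proof. by move=> /andP[t0 t1]; rewrite /clamp (min_idPr t1) (max_idPr t0). Qed.

Lemma clamp_continuous : continuous clamp.
Proof.
move=> t; apply: (@continuous_max _ _ (fun=> 0) (fun t => Num.min 1 t) t).
  exact: cst_continuous.
by apply: (@continuous_min _ _ (fun=> 1) id t); [exact: cst_continuous|exact: cvg_id].
Qed.

Lemma clamp_curve_continuous g : {within `[0, 1]%classic, continuous g} ->
  continuous (g \o clamp).
Proof.
move=> /subspace_continuousP cg t U gU.
have c01 : `[0, 1]%classic (clamp t) by rewrite /= in_itv/= clamp_itv.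
have H : nbhs (clamp t) [set x | `[0, 1]%classic x -> U (g x)] := cg _ c01 U gU.
apply: (@filterS _ (nbhs t) _ _ _ _ (@clamp_continuous t _ H)) => x /=; apply.
by rewrite in_itv/= clamp_itv.
Qed.

Lemma curve_heine (L : R -> CC[R]) : continuous L ->
  forall e, 0 < e -> exists2 d, 0 < d & forall x y, 0 <= x <= 1 -> 0 <= y <= 1 ->
     `|x - y| < d -> normc (L x - L y) < e.
Proof.
move=> cL e e0; have e2 : 0 < e / 2 by rewrite divr_gt0.
have [d d0 hd] : exists2 d : R, 0 < d & forall x : R, `[0, 1]%classic x ->
    forall y, `|x - y| < d -> normc (L x - L y) < e.
  apply: (compact_uniform (P := fun d x => forall y, `|x - y| < d ->
     normc (L x - L y) < e) (@segment_compact R 0 1)).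
    by move=> d d' x dd h y hy; apply: h; exact: lt_le_trans hy dd.
  move=> x _; have P := (cvg_normcP (F := nbhs x) L (L x)).1 (cL x).
  have /(@nbhs_normP R R^o)[d /= d0 hd] := P (nbhs_filter x) _ e2; exists (d / 2); first by
    rewrite divr_gt0.
  apply/(@nbhs_normP R R^o); exists (d / 2); first by rewrite /= divr_gt0.
  move=> y /= xy r yr.
  have h1 := hd y; have h2 := hd r; rewrite /ball_/= in h1 h2.
  have {}h1 : normc (L y - L x) < e / 2.
    by apply: h1; apply: lt_le_trans xy _; rewrite ler_pdivrMr// ler_pMr// ler1n.
  have {}h2 : normc (L r - L x) < e / 2.
    apply: h2; apply: le_lt_trans (ler_distD y _ _) _.
    by rewrite [d]splitr ltrD.
  have := ler_normc_dist (L y) (L x) (L r); rewrite (normcB (L x) (L r)); lra.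
by exists d => // x y hx hy; apply: hd; rewrite /= in_itv.
Qed.

(** The curve is spread over the plane as z |-> g(clamp(Re z)) - b, which never vanishes; a
    logarithm of it on the unit disc, restricted to [0,1], is a logarithm along the curve. *)
Lemma curve_log g b : {within `[0, 1]%classic, continuous g} -> ~ trace g b ->
  exists L : R -> CC[R], [/\ continuous L,
    forall t, 0 <= t <= 1 -> cexp (L t) = g t - b &
    rectifiable g -> is_contour_integral g (fun z => (z - b)^-1) (L 1 - L 0)].
Proof.
move=> cg gb; pose G (z : CC[R]) : CC[R] := (g \o clamp) (complex.Re z) - b.
have G0 z : G z != 0.
  apply/eqP => /subr0_eq h; apply: gb; exists (clamp (complex.Re z)) => //=.
  by rewrite in_itv/= clamp_itv.
have cgc := clamp_curve_continuous cg.
have cG : continuous G.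
  move=> z; apply: (ctsD (f := fun z => (g \o clamp) (complex.Re z)) (h := fun=> - b)).
    2: exact: cts_cst.
  apply: (@continuous_comp _ _ _ (@complex.Re R : CC[R] -> R)).
    exact: Re_continuous.
  exact: cgc.
have [Lam hLam] := continuous_logarithm 1 cG G0.
have c1 t : normc ((clamp t)%:C%C : R[i]) <= 1.
  by have /andP[? ?] := clamp_itv t; rewrite normc_real ger0_norm.
pose L t := Lam (clamp t)%:C%C.
have cL : continuous L.
  move=> t; apply: (@continuous_comp _ _ _ (fun t => (clamp t)%:C%C : CC[R]) Lam).
    by apply: (@cvg_ReIm _ _ (nbhs t)); [exact: clamp_continuous|exact: cvg_cst].
  by have [] := hLam _ (c1 t).
have eL t : 0 <= t <= 1 -> cexp (L t) = g t - b.
  by move=> t01; have [_ ->] := hLam _ (c1 t); rewrite /G /= !clamp_id.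
exists L; split => // rg.
have [m m0 hm] : exists2 m : R, 0 < m & forall x : R, `[0, 1]%classic x ->
    m <= normc ((g \o clamp) x - b).
  apply: (compact_uniform (P := fun m x => m <= normc ((g \o clamp) x - b))
    (@segment_compact R 0 1)).
    by move=> d d' x dd h; exact: le_trans dd h.
  move=> x _; set N := normc ((g \o clamp) x - b).
  have N0 : 0 < N / 2.
    rewrite divr_gt0// normc_gt0; have := G0 x%:C%C; by [].
  have P := (cvg_normcP (F := nbhs x) (g \o clamp) _).1 (cgc x).
  have {}P := P (nbhs_filter x) _ N0.
  exists (N / 2) => //; near=> y.
  have h : normc ((g \o clamp) y - (g \o clamp) x) < N / 2 by near: y.
  have := ler_normc_dist ((g \o clamp) x) ((g \o clamp) y) b.
  by rewrite (normcB ((g \o clamp) x) ((g \o clamp) y)) -/N; lra.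
apply: (contour_integral_log rg (curve_heine cL) eL m0) => x x01.
by have := hm x; rewrite /= in_itv/= clamp_id//; apply.
Unshelve. all: by end_near. Qed.

(** As [0,1] is compact, the curve is a closed map, so a function of the parameter that is constant
    on fibres is continuous on the trace; the only nontrivial fibre is {0, 1}. Tietze's theorem
    extends it to the plane, viewed as [R * R]. *)
Lemma curve_descent_real g (m : R -> R) : jordan_curve g -> continuous m -> m 0 = m 1 ->
  exists2 M : CC[R] -> R, continuous M & forall t, 0 <= t <= 1 -> M (g t) = m t.
Proof.
move=> [cg g01 ginj] cm m01.
pose h (t : R) : R * R := (complex.Re (g (clamp t)), complex.Im (g (clamp t))).
have cgc := clamp_curve_continuous cg.
have ch : continuous h.
  move=> t; apply: (cvg_pair (F := nbhs t) (G := nbhs (h t).1) (H := nbhs (h t).2)).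
    apply: (@continuous_comp _ _ _ (g \o clamp) (@complex.Re R : CC[R] -> R)).
      exact: cgc.
    exact: Re_continuous.
  apply: (@continuous_comp _ _ _ (g \o clamp) (@complex.Im R : CC[R] -> R)).
    exact: cgc.
  exact: Im_continuous.
have hinj x y : 0 <= x <= 1 -> 0 <= y <= 1 -> h x = h y -> m x = m y.
  move=> x01 y01 [h1 h2]; rewrite !clamp_id// in h1 h2.
  have {h1 h2} gxy : g x = g y by apply/eqP; rewrite eq_complex h1 h2 !eqxx.
  have [x1|x1] := eqVneq x 1; have [y1|y1] := eqVneq y 1.
  - by rewrite x1 y1.
  - rewrite x1 -m01; congr m; apply: ginj; rewrite ?in_itv/= ?lexx ?ltr01//.
      by move/andP: y01 => [-> ]; rewrite le_eqVlt (negPf y1).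
    by rewrite g01 -x1.
  - rewrite y1 -m01; congr m; apply: ginj; rewrite ?in_itv/= ?lexx ?ltr01//.
      by move/andP: x01 => [-> ]; rewrite le_eqVlt (negPf x1).
    by rewrite g01 -y1.
  congr m; apply: ginj; rewrite ?in_itv//=.
    by move/andP: x01 => [-> ]; rewrite le_eqVlt (negPf x1).
  by move/andP: y01 => [-> ]; rewrite le_eqVlt (negPf y1).
pose I01 : set R := `[0, 1]%classic.
have cI : compact I01 := @segment_compact R 0 1.
pose A := h @` I01.
have closed_h (T : set R) : closed T -> closed (h @` (I01 `&` T)).
  move=> cT; apply: compact_closed; first exact: (@norm_hausdorff R (R * R)%type).
  apply: continuous_compact; first exact: continuous_subspaceT.
  exact: compact_closedI.
have cA : closed A by have := closed_h setT closedT; rewrite setIT.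
(* Any preimage may be picked: by [hinj] the value of [m] does not depend on it. *)
pose f (p : R * R) : R^o := m (xget 0 [set t | I01 t /\ h t = p]).
have fh t : I01 t -> f (h t) = m t.
  move=> It; rewrite /f; case: xgetP => [y _ [Iy hy]|/(_ t)]; last by case.
  by apply: hinj => //; move: Iy It; rewrite /I01/= !in_itv.
have cf : {within A, continuous f}.
  apply/subspace_continuousP => p [t0 It0 <-].
  apply/cvgrPdist_lt => e e0; rewrite -[from_subspace A f (h t0)]/(f (h t0)) fh//.
  (* The parameters where [m] is at least e away from [m t0] have a closed image avoiding [h t0];
     its complement is the required neighbourhood. *)
  pose T : set R := [set t | e <= `|m t0 - m t|].
  have cT : closed T.
    apply: (closed_comp (f := fun t => `|m t0 - m t|) (D := [set x | e <= x])).
      move=> t _; apply: (@continuous_comp _ _ _ (fun t => m t0 - m t) (fun x => `|x|)).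
        by apply: (@cvgB _ _ _ (nbhs t)); [exact: cvg_cst|exact: cm].
      exact: norm_continuous.
    exact: closed_ge.
  have := closed_h T cT; rewrite -openC => oT.
  have : nbhs (h t0) (~` (h @` (I01 `&` T))).
    apply: open_nbhs_nbhs; split => // -[t [It Tt] /esym ht].
    have : m t0 = m t by apply: hinj => //; move: It It0; rewrite /I01/= !in_itv.
    by move: Tt; rewrite /T/= => + mt; rewrite mt subrr normr0 leNgt e0.
  rewrite near_withinE; apply: filterS => q hq [t It tq].
  rewrite -tq -[from_subspace A f (h t)]/(f (h t)) fh// ltNge; apply/negP => Tt; apply: hq;
    exists t => //.
have [B [_ hB]] : bounded_set (m @` I01).
  apply: compact_bounded; apply: continuous_compact cI.
  exact: continuous_subspaceT.
have B1 : B < `|B| + 1 by rewrite (le_lt_trans (ler_norm _))// ltrDl.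
have B0 : 0 < `|B| + 1 by rewrite ltr_wpDl.
have bf p : A p -> `|f p| <= `|B| + 1.
  by move=> [t It <-]; rewrite fh//; apply: (hB _ B1); exists t.
have [M [fM cM _]] := continuous_bounded_extension pseudometric_normal cA B0 cf bf.
exists (fun z => M (complex.Re z, complex.Im z)).
  move=> z; apply: (@continuous_comp _ _ _
    (fun z : CC[R] => (complex.Re z, complex.Im z)) M); last exact: cM.
  by apply: (cvg_pair (F := nbhs z) (G := nbhs (complex.Re z)) (H := nbhs (complex.Im z)));
    [exact: Re_continuous|exact: Im_continuous].
move=> t t01; rewrite -[in g t](clamp_id t01) -[(_, _)]/(h t) -fM ?fh//.
  by rewrite inE; exists t.
Qed.

End Winding.

(** * No winding about points outside the domain *)

Section WindingOutside.
Context {R : realType}.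
Implicit Types (g : R -> CC[R]) (a b z : CC[R]) (e t : R) (Omega : set CC[R]).

Local Notation tau := (pi *+ 2 : R).

(** Reducing the imaginary part modulo 2 pi leaves r in [0, 2 pi) with cos r = 1; since cos r = 1 -
    2 sin(r/2)^2 and the sine is positive on (0, pi), r = 0. *)
Lemma cexp_eq1 (x : R[i]) : cexp x = 1 ->
  exists k : int, x = (0 +i* (tau *~ k))%C.
Proof.
case: x => u v /= ex.
have /eqP : cexp (u +i* v)%C = 1 by [].
rewrite eq_complex /= => /andP[/eqP h1 /eqP h2].
have e0 := expR_gt0 u.
have s0 : sin v = 0 by move/eqP: h2; rewrite mulf_eq0 gt_eqF// => /eqP.
have c1 : cos v = 1.
  have c2 : cos v ^+ 2 = 1 by have := cos2Dsin2 v; rewrite s0 expr0n addr0.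
  have /eqP := c2; rewrite sqrf_eq1 => /orP[/eqP//|/eqP cN]; move: h1; rewrite cN; lra.
have u0 : u = 0 by apply: expR_inj; rewrite expR0; move: h1; rewrite c1 mulr1.
have tau0 : 0 < tau by rewrite mulrn_wgt0// pi_gt0.
pose k := Num.floor (v / tau); exists k.
suff : v = tau *~ k by move=> <-; rewrite u0.
pose r := v - tau *~ k.
have r0 : 0 <= r by rewrite subr_ge0 -mulrzr mulrC -ler_pdivlMr// floor_le.
have rt : r < tau.
  rewrite ltrBlDl -mulrzr -[X in _ < _ + X]mulr1 -mulrDr mulrC -ltr_pdivrMr//.
  by have /andP[_] := floor_itv (v / tau); rewrite intrD.
have cr : cos r = 1.
  suff H (m : nat) x : cos (x + tau *+ m) = cos x.
    rewrite /r; case: {r r0 rt} k => m; rewrite -?pmulrn ?NegzE ?mulrNz ?opprK -?pmulrn.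
      by rewrite -(H m) subrK.
    by rewrite H.
  elim: m => [|m IH]; first by rewrite addr0.
  by rewrite mulrSr addrA cosD2pi.
apply/eqP; rewrite -subr_eq0 -/r; apply/negPn/negP => rn0.
have r2 : 0 < r / 2 by rewrite divr_gt0// lt_neqAle eq_sym rn0.
have : 0 < sin (r / 2).
  by apply: sin_gt0_pi; rewrite r2 ltr_pdivrMr// mulr_natr.
move: cr; rewrite {1}(splitr r) cosD -!expr2 cos2sin2 => h h3.
have : sin (r / 2) ^+ 2 = 0 by lra.
by move/eqP; rewrite sqrf_eq0 gt_eqF.
Qed.

Lemma cts_near_eq (f h : CC[R] -> CC[R]) z : (\forall y \near z, f y = h y) ->
  {for z, continuous f} -> {for z, continuous h}.
Proof.
move=> fh cf; have fhz : f z = h z := nbhs_singleton fh.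
move=> U; rewrite -fhz => /cf fU; apply: (@filterS2 _ (nbhs z) _ _ _ _ _ fh fU).
by move=> y /= ->.
Qed.

Lemma bounded_set_normc (A : set CC[R]) : bounded_set A ->
  exists B : R, forall z, A z -> normc z <= B.
Proof.
move=> [B [Br hB]]; exists (complex.Re B + 1) => z Az.
have := hB (complex.Re B + 1)%:C%C; rewrite -{1}(RRe_real Br) ltcR ltrDl ltr01.
by move=> /(_ isT z Az) /=; rewrite -[Num.Def.normr _]/(`|z : R[i]|) norm_normc lecR.
Qed.

Lemma curve_descent g (m : R -> CC[R]) : jordan_curve g -> continuous m -> m 0 = m 1 ->
  exists2 M : CC[R] -> CC[R], continuous M & forall t, 0 <= t <= 1 -> M (g t) = m t.
Proof.
move=> jg cm m01.
have [M1 cM1 hM1] : exists2 M : CC[R] -> R, continuous M &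
    forall t, 0 <= t <= 1 -> M (g t) = complex.Re (m t).
  apply: curve_descent_real => //; last by rewrite m01.
  move=> t; apply: (@continuous_comp _ _ _ m (@complex.Re R : CC[R] -> R)).
    exact: cm.
  exact: Re_continuous.
have [M2 cM2 hM2] : exists2 M : CC[R] -> R, continuous M &
    forall t, 0 <= t <= 1 -> M (g t) = complex.Im (m t).
  apply: curve_descent_real => //; last by rewrite m01.
  move=> t; apply: (@continuous_comp _ _ _ m (@complex.Im R : CC[R] -> R)).
    exact: cm.
  exact: Im_continuous.
exists (fun z => (M1 z +i* M2 z)%C).
  by move=> z; apply: cts_real_complex; [exact: cM1|exact: cM2].
by move=> t t01; rewrite hM1// hM2//; case: (m t).
Qed.

(* If the boundary values of [h] on Omega wound n times, then [h] could be
   corrected by a factor exp(-M) so as to agree with (z - a)^n on the boundary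
   curve; gluing would give a nonvanishing function on the whole plane which is
   (z - a)^n near infinity, and such a function has a logarithm. *)
Lemma no_winding g Omega a (h : CC[R] -> CC[R]) (l La : R -> CC[R]) n :
  bounded_domain Omega -> jordan_curve g -> trace g = boundary Omega -> Omega a ->
  (forall z, closure Omega z -> {for z, continuous h} /\ h z != 0) ->
  continuous l -> (forall t, 0 <= t <= 1 -> cexp (l t) = h (g t)) ->
  continuous La -> (forall t, 0 <= t <= 1 -> cexp (La t) = g t - a) ->
  l 1 - l 0 = (La 1 - La 0) *+ n -> n = 0%N.
Proof.
move=> [oO _ _ bO] jg tg Oa hh cl el cLa eLa ln.
pose m t : CC[R] := l t - La t *+ n.
have cm : continuous m.
  move=> t; apply: (@cvgB R[i] CC[R] _ (nbhs t)); first exact: cl.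
  by apply: (@cvgMn R[i] CC[R] _ (nbhs t)); exact: cLa.
have m01 : m 0 = m 1.
  have -> : m 1 = l 0 + (La 1 - La 0) *+ n - La 1 *+ n.
    by rewrite /m -ln [X in _ = X - _]addrC subrK.
  by rewrite mulrnBl addrCA [X in _ = X]addrC addKr.
have [M cM hM] := curve_descent jg cm m01.
pose F1 z : CC[R] := h z * cexp (- M z).
pose F2 z : CC[R] := (z - a) ^+ n.
pose G z : CC[R] := if z \in Omega then F1 z else F2 z.
have cF2 z : {for z, continuous F2}.
  by apply: (ctsX (f := fun z => z - a)); apply: ctsD; [exact: cvg_id|exact: cts_cst].
have cF1 z : closure Omega z -> {for z, continuous F1}.
  move=> Oz; apply: ctsM; first by have [] := hh _ Oz.
  apply: (cts_comp (f := fun z => - M z) (h := cexp)); last exact: cexp_continuous.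
  by apply: ctsN; exact: cM.
have F12 z : boundary Omega z -> F1 z = F2 z.
  rewrite -tg => -[t]; rewrite /= in_itv/= => t01 <-.
  rewrite /F1 /F2 hM// /m opprB cexpB cexpMn eLa// el// mulrC divfK//.
  rewrite -el//; exact: cexp_neq0.
have G0 z : G z != 0.
  rewrite /G; case: ifPn => [/set_mem Oz|/negP Oz].
    by rewrite mulf_neq0 ?cexp_neq0//; have [] := hh _ (subset_closure Oz).
  by rewrite expf_neq0// subr_eq0; apply: contra_notN Oz => /eqP ->; rewrite inE.
have cG : continuous G.
  move=> z; have [Oz|Oz] := pselect (closure Omega z); last first.
    have oC : open (~` closure Omega) by rewrite openC; exact: closed_closure.
    apply: (cts_near_eq _ (cF2 z)).
    have : nbhs z (~` closure Omega) by apply: open_nbhs_nbhs.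
    apply: filterS => y Oy; rewrite /G memNset// => Oy'; apply: Oy.
    exact: subset_closure.
  have [Oz'|Oz'] := pselect (Omega z).
    apply: (cts_near_eq _ (cF1 z Oz)).
    have : nbhs z Omega by apply: open_nbhs_nbhs.
    by apply: filterS => y Oy; rewrite /G mem_set.
  (* At a boundary point [F1] and [F2] take the same value, so the smaller of the two radii works
     whichever branch a nearby point falls in. *)
  have Bz : boundary Omega z by split => //; rewrite (interior_id _).1.
  have Gz : G z = F2 z by rewrite /G memNset.
  apply/cts_normcP => e e0.
  have [d1 d10 h1] := (cts_normcP F1 z).1 (cF1 z Oz) e e0.
  have [d2 d20 h2] := (cts_normcP F2 z).1 (cF2 z) e e0.
  exists (Num.min d1 d2); first by rewrite lt_min d10.
  move=> y; rewrite lt_min Gz /G => /andP[y1 y2]; case: ifPn => _; last exact: h2.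
  by rewrite -F12//; exact: h1.
have [B hB0] := bounded_set_normc bO.
have hB z : Omega z -> normc (z - a) < `|B| + 1 + normc a.
  move=> Oz; apply: le_lt_trans (le_normcD _ _) _; rewrite normcN ltrD2r.
  by apply: le_lt_trans (hB0 _ Oz) _; rewrite (le_lt_trans (ler_norm _))// ltrDl.
(* Larger than the distance from a to any point of [Omega]: the circle [zt] of this radius avoids
   [Omega], so [G] is (z - a)^n on it. *)
pose rho := `|B| + 1 + normc a.
have rho0 : 0 < rho by rewrite /rho ltr_pwDl ?normc_ge0// ltr_wpDl.
have [Lam hLam] := continuous_logarithm (rho + normc a) cG G0.
pose zt (t : R) : CC[R] := a + rho%:C%C * cexp (0 +i* t)%C.
have nce t : normc (cexp (0 +i* t)%C) = 1.
  by rewrite /cexp /= expR0 !mul1r cos2Dsin2 sqrtr1.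
have ztn t : normc (zt t) <= rho + normc a.
  apply: le_trans (le_normcD _ _) _; rewrite addrC lerD2r normcM nce mulr1.
  by rewrite normc_real gtr0_norm.
have czt : continuous zt.
  move=> t; apply: (@cvgD R[i] CC[R] _ (nbhs t)); first exact: cvg_cst.
  apply: (@cvgM R[i] _ (nbhs t)); first exact: cvg_cst.
  apply: (@continuous_comp _ _ _ (fun t => (0 +i* t)%C : CC[R]) cexp).
    by apply: (@cvg_ReIm _ _ (nbhs t)); [exact: cvg_cst|exact: cvg_id].
  exact: cexp_continuous.
(* The excess of the continuous argument of [G] on the circle over n t. As G(zt t) = rho^n exp(int),
   the cosine of [D] is positive throughout; but [D] drops by 2 pi n over one turn, so for n > 0 it
   would pass through [D 0 - pi], where the cosine is negative. *)
pose D t := complex.Im (Lam (zt t)) - t *+ n.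
have cD : continuous D.
  move=> t; apply: (@cvgB _ _ _ (nbhs t)); last first.
    by apply: (@cvgMn _ _ _ (nbhs t)); exact: cvg_id.
  apply: (@continuous_comp _ _ _ (fun t => Lam (zt t)) (@complex.Im R : CC[R] -> R)).
    apply: (@continuous_comp _ _ _ zt Lam); first exact: czt.
    by have [] := hLam _ (ztn t).
  exact: Im_continuous.
have eD t : 0 < cos (D t).
  have [_ eL] := hLam _ (ztn t).
  have zO : zt t \notin Omega.
    apply/negP => /set_mem /hB; rewrite /zt addrAC subrr add0r normcM nce mulr1.
    by rewrite normc_real gtr0_norm// -/rho ltxx.
  have : cexp (Lam (zt t) - (0 +i* t)%C *+ n) = rho%:C%C ^+ n.
    rewrite cexpB eL /G (negPf zO) /F2 /zt addrAC subrr add0r exprMn.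
    by rewrite cexpMn mulfK// expf_neq0// cexp_neq0.
  rewrite -rmorphXn => /(congr1 (@complex.Re R)).
  rewrite /cexp/= raddfB raddfMn /= mul0rn subr0 raddfB raddfMn /= -/(D t) => hD.
  have : 0 < rho ^+ n by rewrite exprn_gt0.
  by rewrite -hD pmulr_rgt0// expR_gt0.
have ztau : zt tau = zt 0.
  by rewrite /zt /cexp /= cos2pi sin2pi cos0 sin0.
case: (posnP n) => [//|n0]; exfalso.
have tau0 : 0 < tau by rewrite mulrn_wgt0// pi_gt0.
have D1 : D tau = D 0 - tau *+ n by rewrite /D ztau mul0rn subr0.
have tn : tau <= tau *+ n by rewrite -(prednK n0) [X in _ <= X]mulrS lerDl mulrn_wge0// ltW.
have [t _ Dt] : exists2 t, t \in `[0, tau] & D t = D 0 - pi.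
  apply: IVT; [exact: ltW|exact: continuous_subspaceT|].
  have := pi_gt0 R; rewrite D1 ge_min le_max; move: tn tau0.
  set N := tau *+ n => tn tau0 p0; apply/andP; split; apply/orP.
    by right; lra.
  by left; lra.
have := eD t; rewrite Dt cosB cospi sinpi mulr0 addr0 mulrN1 oppr_gt0.
by rewrite ltNge ltW.
Qed.

End WindingOutside.

Section WindingNumbers.
Context {R : realType}.
Implicit Types (g : R -> CC[R]) (a b z : CC[R]) (Omega : set CC[R]).

Local Notation twopii := (2 * pi%:C%C * 'i%C : R[i]).

Lemma twopii_neq0 : twopii != 0.
Proof.
rewrite !mulf_neq0 ?pnatr_eq0//; first by rewrite eq_complex/= eqxx andbT gt_eqF// pi_gt0.
by rewrite eq_complex/= oner_eq0 andbF.
Qed.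

Lemma interior_point_notin_trace g Omega a :
  open Omega -> trace g = boundary Omega -> Omega a -> ~ trace g a.
Proof. by move=> oO -> Oa [_]; rewrite (interior_id _).1. Qed.

Lemma positively_oriented_log g Omega a (L : R -> CC[R]) :
  positively_oriented g Omega -> Omega a ->
  is_contour_integral g (fun z => (z - a)^-1) (L 1 - L 0) -> L 1 - L 0 = twopii.
Proof.
move=> po Oa /contour_integral_val hv; have := po _ Oa.
rewrite /winding_number hv => h.
by rewrite -[LHS](mulVKf twopii_neq0) h mulr1.
Qed.

(** Orientation speaks of [contour_integral], which has a default value; [curve_log] supplies the
    existence that turns it into a genuine integral. *)
Lemma contour_integral_inside g Omega a : bounded_domain Omega -> jordan_curve g ->
  rectifiable g -> trace g = boundary Omega -> positively_oriented g Omega -> Omega a ->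
  is_contour_integral g (fun z => (z - a)^-1) twopii.
Proof.
move=> [oO _ _ _] [cg _ _] rg tg po Oa.
have [L [_ _ /(_ rg) iL]] := curve_log cg (interior_point_notin_trace oO tg Oa).
by rewrite -(positively_oriented_log po Oa iL).
Qed.

(** The curve is closed, so the logarithm of [g - b] grows by 2 pi i k for an integer k.
    [no_winding] takes a natural exponent: it is applied to z - b when k >= 0, and to its inverse,
    with logarithm [- Lb], when k <= 0. *)
Lemma contour_integral_outside g Omega b : bounded_domain Omega -> jordan_curve g ->
  rectifiable g -> trace g = boundary Omega -> positively_oriented g Omega ->
  ~ closure Omega b -> is_contour_integral g (fun z => (z - b)^-1) 0.
Proof.
move=> bO jg rg tg po Ob; have [cg g01 _] := jg; have [oO _ [a Oa] _] := bO.
have tb : ~ trace g b by rewrite tg => -[].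
have [La [cLa eLa /(_ rg) iLa]] := curve_log cg (interior_point_notin_trace oO tg Oa).
have [Lb [cLb eLb /(_ rg) iLb]] := curve_log cg tb.
have dLa := positively_oriented_log po Oa iLa.
have [k hk] : exists k : int, Lb 1 - Lb 0 = twopii *~ k.
  have : cexp (Lb 1 - Lb 0) = 1.
    rewrite cexpB !eLb ?lexx ?ler01// -g01 divff// subr_eq0.
    by apply: contra_notN tb => /eqP <-; exists 0 => //=; rewrite in_itv/= lexx ler01.
  move=> /cexp_eq1[k ->]; exists k.
  have iE (x : R) : (0 +i* x)%C = 'i%C * x%:C%C.
    by apply/eqP; rewrite eq_complex /=; apply/andP; split; apply/eqP; ring.
  by rewrite iE rmorphMz rmorphMn /= mulrzAr; congr (_ *~ _); ring.
suff dLb : Lb 1 - Lb 0 = 0 by rewrite -dLb.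
have cb z : closure Omega z -> {for z, continuous (fun z : CC[R] => z - b : CC[R])}
    /\ z - b != 0.
  move=> Oz; split; first by apply: (ctsD (f := id)); [exact: cvg_id|exact: cts_cst].
  by rewrite subr_eq0; apply: contra_notN Ob => /eqP <-.
have [n [kn|kn]] : exists n : nat, k = n%:Z \/ k = - n%:Z.
  by case: k {hk} => n; [exists n; left|exists n.+1; right; rewrite NegzE].
- suff n0 : n = 0%N by rewrite hk kn n0 mulr0z.
  apply: (no_winding bO jg tg Oa cb cLb _ cLa eLa) => [t t01|].
    by rewrite eLb.
  by rewrite hk kn dLa pmulrn.
suff n0 : n = 0%N by rewrite hk kn n0 oppr0 mulr0z.
apply: (@no_winding _ g Omega a (fun z => (z - b)^-1) (fun t => - Lb t) La n bO jg tg Oa _ _ _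
  cLa eLa).
- move=> z /cb[h1 h2]; split; last by rewrite invr_eq0.
  by apply: (ctsV (f := fun z => z - b)).
- by move=> t; apply: (@cvgN R[i] CC[R] _ (nbhs t)); exact: cLb.
- by move=> t t01; rewrite cexpN eLb.
by rewrite -opprD hk kn dLa mulrNz opprK pmulrn.
Qed.

End WindingNumbers.

(** * Integrals over segments and rectangles *)

Section ComplexIntegral.
Context {R : realType}.
Implicit Types (f : R -> R) (u v : R -> CC[R]) (a b c x : R).

(** Not an oriented integral: [[a, b]] is empty when b < a and the value is then 0. Orientation is
    carried by explicit signs in [rectint]. *)
Definition rint f a b : R := \int[lebesgue_measure]_(x in `[a, b]) f x.

(** Two-sided continuity, endpoints included; adjacent intervals can then be split and restricted
    without subspace topologies. *)
Definition continuous_itv {T : topologicalType} (u : R -> T) a b :=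
  forall x, a <= x <= b -> {for x, continuous u}.

Lemma continuous_itv_sub {T : topologicalType} (u : R -> T) a b a' b' :
  a <= a' -> b' <= b -> continuous_itv u a b -> continuous_itv u a' b'.
Proof.
move=> aa bb cu x /andP[h1 h2]; apply: cu.
by rewrite (le_trans aa h1) (le_trans h2 bb).
Qed.

Lemma continuous_itv_integrable f a b : continuous_itv f a b ->
  lebesgue_measure.-integrable `[a, b] (EFin \o f).
Proof.
move=> cf; apply: continuous_compact_integrable; first exact: segment_compact.
apply/subspace_continuousP => x /=; rewrite in_itv/= => xab.
exact: cvg_within_filter (cf x xab).
Qed.

Lemma rint_split f a b c : a <= c -> c <= b -> continuous_itv f a b ->
  rint f a b = rint f a c + rint f c b.
Proof.
move=> ac cb cf; rewrite /rint addrC; apply/eqP; rewrite -subr_eq; apply/eqP.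
rewrite Rintegral_itvB; [|exact: continuous_itv_integrable| |].
- apply: Rintegral_itv_obnd_cbnd.
  apply: (integrableS _ _ _ (continuous_itv_integrable (continuous_itv_sub ac _ cf))) => //.
  by apply: subset_itvr; rewrite bnd_simp.
- by rewrite bnd_simp.
- by rewrite bnd_simp.
Qed.

Lemma eq_rint f h a b : (forall x, a <= x <= b -> f x = h x) -> rint f a b = rint h a b.
Proof.
move=> fh; apply: eq_Rintegral => x; rewrite inE /= in_itv/=; exact: fh.
Qed.

Lemma rintD f h a b : continuous_itv f a b -> continuous_itv h a b ->
  rint (fun x => f x + h x) a b = rint f a b + rint h a b.
Proof.
by move=> cf ch; apply: RintegralD => //; exact: continuous_itv_integrable.
Qed.

Lemma rintZ f k a b : continuous_itv f a b ->
  rint (fun x => k * f x) a b = k * rint f a b.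
Proof. by move=> cf; apply: RintegralZl => //; exact: continuous_itv_integrable. Qed.

Lemma rint_FTC (F f : R -> R) a b : a <= b -> (forall x, is_derive x 1 F (f x)) ->
  continuous_itv f a b -> rint f a b = F b - F a.
Proof.
rewrite le_eqVlt => /predU1P[->|ab] dF cf.
  by rewrite subrr /rint set_itv1 Rintegral_set1.
have cF x : {for x, continuous F}.
  by apply: differentiable_continuous; apply/derivable1_diffP.
rewrite /rint /Rintegral (@continuous_FTC2 _ f F) //.
- apply/subspace_continuousP => x /=; rewrite in_itv/= => xab.
  exact: cvg_within_filter (cf x xab).
- split.
  + by move=> x _; apply: ex_derive.
  + exact: cvg_at_right_filter (cF a).
  + exact: cvg_at_left_filter (cF b).
- by move=> x _; rewrite derive1E derive_val.
Qed.

Lemma rint_cst k a b : a <= b -> rint (fun=> k) a b = k * (b - a).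
Proof.
move=> ab; rewrite mulrBr; apply: (@rint_FTC (fun x => k * x)) => //.
  by move=> x; apply: is_derive_eq; rewrite [_ *: _]mulr1.
by move=> x _; exact: cst_continuous.
Qed.

Lemma rint_id a b : a <= b -> rint id a b = (b ^+ 2 - a ^+ 2) / 2.
Proof.
move=> ab; rewrite mulrBl; apply: (@rint_FTC (fun x => x ^+ 2 / 2)) => //.
  move=> x; apply: is_derive_eq; rewrite !scaler0 add0r.
  by rewrite (_ : x%:A = x) -?[_ *: _]/(_ * _); [field|exact: mulr1].
by move=> x _; exact: cvg_id.
Qed.

Lemma rint_le f k a b : a <= b -> continuous_itv f a b ->
  (forall x, a <= x <= b -> `|f x| <= k) -> `|rint f a b| <= k * (b - a).
Proof.
move=> ab cf fk; rewrite -rint_cst//.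
apply: le_trans (le_normr_Rintegral _ (continuous_itv_integrable cf)) _ => //.
apply: le_Rintegral => //.
  apply: (@continuous_itv_integrable (fun x => `|f x|)) => x xab.
  exact: cvg_norm (cf x xab).
by apply: (@continuous_itv_integrable (fun=> k)) => x _; exact: cst_continuous.
Qed.

Definition cint u a b : CC[R] :=
  (rint (fun x => complex.Re (u x)) a b +i* rint (fun x => complex.Im (u x)) a b)%C.

Lemma continuous_itv_Re u a b : continuous_itv u a b ->
  continuous_itv (fun x => complex.Re (u x)) a b.
Proof.
move=> cu x xab; apply: (@continuous_comp _ _ _ u (@complex.Re R : CC[R] -> R)).
  exact: cu.
exact: Re_continuous.
Qed.

Lemma continuous_itv_Im u a b : continuous_itv u a b ->
  continuous_itv (fun x => complex.Im (u x)) a b.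
Proof.
move=> cu x xab; apply: (@continuous_comp _ _ _ u (@complex.Im R : CC[R] -> R)).
  exact: cu.
exact: Im_continuous.
Qed.

Lemma continuous_itvD u v a b : continuous_itv u a b -> continuous_itv v a b ->
  continuous_itv (fun x => u x + v x) a b.
Proof.
by move=> cu cv x xab; apply: (@cvgD R[i] CC[R] _ (nbhs x) _ u v); [exact: cu|exact: cv].
Qed.

Lemma continuous_itvM u v a b : continuous_itv u a b -> continuous_itv v a b ->
  continuous_itv (fun x => u x * v x) a b.
Proof.
by move=> cu cv x xab; apply: (@cvgM R[i] _ (nbhs x) _ u v); [exact: cu|exact: cv].
Qed.

Lemma continuous_itv_cst (k : CC[R]) a b : continuous_itv (fun=> k) a b.
Proof. by move=> x _; exact: cst_continuous. Qed.

Lemma continuous_itvN u a b : continuous_itv u a b ->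
  continuous_itv (fun x => - u x) a b.
Proof. by move=> cu x xab; apply: (@cvgN R[i] CC[R] _ (nbhs x) _ u); exact: cu. Qed.

Lemma continuous_itvV u a b : continuous_itv u a b ->
  (forall x, a <= x <= b -> u x != 0) -> continuous_itv (fun x => (u x)^-1) a b.
Proof.
by move=> cu u0 x xab; apply: (@cvgV R[i] _ (nbhs x) _ u); [exact: u0|exact: cu].
Qed.

Lemma eq_cint u v a b : (forall x, a <= x <= b -> u x = v x) -> cint u a b = cint v a b.
Proof. by move=> uv; rewrite /cint; congr (_ +i* _)%C; apply: eq_rint => x /uv ->. Qed.

Lemma cint_split u a b c : a <= c -> c <= b -> continuous_itv u a b ->
  cint u a b = cint u a c + cint u c b.
Proof.
move=> ac cb cu; rewrite /cint (rint_split ac cb (continuous_itv_Re cu)).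
by rewrite (rint_split ac cb (continuous_itv_Im cu)).
Qed.

Lemma cintD u v a b : continuous_itv u a b -> continuous_itv v a b ->
  cint (fun x => u x + v x) a b = cint u a b + cint v a b.
Proof.
move=> cu cv; rewrite /cint.
rewrite -[RHS]/((_ + _) +i* (_ + _))%C -!rintD; try exact: continuous_itv_Re;
  try exact: continuous_itv_Im.
by congr (_ +i* _)%C; apply: eq_rint => x _; rewrite raddfD.
Qed.

Lemma cintZ u (k : CC[R]) a b : continuous_itv u a b ->
  cint (fun x => k * u x) a b = k * cint u a b.
Proof.
move=> cu; have cr := continuous_itv_Re cu; have ci := continuous_itv_Im cu.
have cZ f l : continuous_itv f a b -> continuous_itv (fun x => l * f x) a b.
  by move=> cf x xab; apply: (@cvgM _ _ (nbhs x)); [exact: cvg_cst|exact: cf].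
case: k => k l; rewrite /cint; apply/eqP; rewrite eq_complex /=; apply/andP; split; apply/eqP.
  transitivity (rint (fun x => k * complex.Re (u x) + - l * complex.Im (u x)) a b).
    by apply: eq_rint => x _; case: (u x) => p q /=; rewrite mulNr.
  by rewrite rintD ?rintZ ?mulNr//; exact: cZ.
transitivity (rint (fun x => k * complex.Im (u x) + l * complex.Re (u x)) a b).
  by apply: eq_rint => x _; case: (u x) => p q.
by rewrite rintD ?rintZ//; exact: cZ.
Qed.

Lemma cintN u a b : continuous_itv u a b -> cint (fun x => - u x) a b = - cint u a b.
Proof.
move=> cu; rewrite -mulN1r -cintZ//; apply: eq_cint => x _; by rewrite mulN1r.
Qed.

Lemma cintB u v a b : continuous_itv u a b -> continuous_itv v a b ->
  cint (fun x => u x - v x) a b = cint u a b - cint v a b.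
Proof. by move=> cu cv; rewrite -(cintN cv) -(cintD cu (continuous_itvN cv)). Qed.

(** The factor 2 comes from bounding real and imaginary parts separately; the limit arguments below
    absorb it. *)
Lemma cint_le u k a b : a <= b -> continuous_itv u a b ->
  (forall x, a <= x <= b -> normc (u x) <= k) -> normc (cint u a b) <= 2 * k * (b - a).
Proof.
move=> ab cu uk; apply: le_trans (normc_le_ReIm _) _ => /=.
rewrite -mulrA mulr2n mulrDl mul1r lerD// rint_le//.
- exact: continuous_itv_Re.
- by move=> x xab; rewrite (le_trans (ler_normc_Re _))// uk.
- exact: continuous_itv_Im.
- by move=> x xab; rewrite (le_trans (ler_normc_Im _))// uk.
Qed.

Lemma cint_cst (k : CC[R]) a b : a <= b -> cint (fun=> k) a b = k * (b - a)%:C%C.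
Proof.
move=> ab; rewrite /cint !rint_cst//; case: k => k l.
by apply/eqP; rewrite eq_complex /=; apply/andP; split; apply/eqP; ring.
Qed.

Lemma continuous_itv_real a b : continuous_itv (fun x => x%:C%C : CC[R]) a b.
Proof.
by move=> x _; apply: (@cvg_ReIm _ _ (nbhs x)); [exact: cvg_id|exact: cvg_cst].
Qed.

Lemma cint_real a b : a <= b -> cint (fun x => x%:C%C) a b = ((b ^+ 2 - a ^+ 2) / 2)%:C%C.
Proof. by move=> ab; rewrite /cint rint_id// rint_cst// mul0r. Qed.

Lemma cint_affine (k l : CC[R]) a b : a <= b ->
  cint (fun x => k + l * x%:C%C) a b =
  k * (b - a)%:C%C + l * ((b ^+ 2 - a ^+ 2) / 2)%:C%C.
Proof.
move=> ab; have cr := @continuous_itv_real a b.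
have cl := continuous_itvM (@continuous_itv_cst l a b) cr.
by rewrite (cintD (@continuous_itv_cst k a b) cl) (cint_cst _ ab) (cintZ _ cr) (cint_real ab).
Qed.

End ComplexIntegral.

(** * Boundary integrals of rectangles *)

Section Goursat.
Context {R : realType}.
Implicit Types (F G : CC[R] -> CC[R]) (z : CC[R]) (a b c d x y k e : R).

Definition in_rect a b c d z : Prop :=
  a <= complex.Re z <= b /\ c <= complex.Im z <= d.

(** The counterclockwise integral of F(z) dz: bottom, right, top, left, with dz = i dy on vertical
    sides. *)
Definition rectint F a b c d : CC[R] :=
  cint (fun x => F (x +i* c)%C) a b + 'i%C * cint (fun y => F (b +i* y)%C) c d
  - cint (fun x => F (x +i* d)%C) a b - 'i%C * cint (fun y => F (a +i* y)%C) c d.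

Definition in_frame a b c d z : Prop := in_rect a b c d z /\
  (complex.Re z = a \/ complex.Re z = b \/ complex.Im z = c \/ complex.Im z = d).

(** Continuity is asked on the boundary only, so that a pole inside the rectangle is allowed. *)
Definition continuous_frame F a b c d :=
  forall z, in_frame a b c d z -> {for z, continuous F}.

Lemma in_rect_sub a b c d a' b' c' d' z : a <= a' -> b' <= b -> c <= c' -> d' <= d ->
  in_rect a' b' c' d' z -> in_rect a b c d z.
Proof.
move=> aa bb cc dd [/andP[h1 h2] /andP[h3 h4]]; split.
  by rewrite (le_trans aa h1) (le_trans h2 bb).
by rewrite (le_trans cc h3) (le_trans h4 dd).
Qed.

Lemma continuous_hseg F a b y :
  (forall x, a <= x <= b -> {for (x +i* y)%C : CC[R], continuous F}) ->
  continuous_itv (fun x => F (x +i* y)%C) a b.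
Proof.
move=> cF x xab; apply: (@continuous_comp _ _ _ (fun x => (x +i* y)%C : CC[R]) F).
  by apply: (@cvg_ReIm _ _ (nbhs x)); [exact: cvg_id|exact: cvg_cst].
exact: cF.
Qed.

Lemma continuous_vseg F c d x :
  (forall y, c <= y <= d -> {for (x +i* y)%C : CC[R], continuous F}) ->
  continuous_itv (fun y => F (x +i* y)%C) c d.
Proof.
move=> cF y ycd; apply: (@continuous_comp _ _ _ (fun y => (x +i* y)%C : CC[R]) F).
  by apply: (@cvg_ReIm _ _ (nbhs y)); [exact: cvg_cst|exact: cvg_id].
exact: cF.
Qed.

Lemma continuous_frame_hseg F a b c d y : continuous_frame F a b c d ->
  c <= y <= d -> y = c \/ y = d -> continuous_itv (fun x => F (x +i* y)%C) a b.
Proof.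
move=> cF ycd e; apply: continuous_hseg => x xab; apply: cF; split => //=.
by right; right.
Qed.

Lemma continuous_frame_vseg F a b c d x : continuous_frame F a b c d ->
  a <= x <= b -> x = a \/ x = b -> continuous_itv (fun y => F (x +i* y)%C) c d.
Proof.
move=> cF xab e; apply: continuous_vseg => y ycd; apply: cF; split => //=.
by case: e; [left|right; left].
Qed.

Lemma rectint_hsplit F a b c d x : a <= x -> x <= b -> c <= d ->
  continuous_frame F a b c d ->
  rectint F a b c d = rectint F a x c d + rectint F x b c d.
Proof.
move=> ax xb cd cF.
have cc : c <= c <= d by rewrite lexx.
have dd : c <= d <= d by rewrite cd lexx.
rewrite /rectint (cint_split ax xb (continuous_frame_hseg cF cc (or_introl erefl))).
rewrite (cint_split ax xb (continuous_frame_hseg cF dd (or_intror erefl))); ring.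
Qed.

Lemma rectint_vsplit F a b c d y : c <= y -> y <= d -> a <= b ->
  continuous_frame F a b c d ->
  rectint F a b c d = rectint F a b c y + rectint F a b y d.
Proof.
move=> cy yd ab cF.
have aa : a <= a <= b by rewrite lexx.
have bb : a <= b <= b by rewrite ab lexx.
rewrite /rectint (cint_split cy yd (continuous_frame_vseg cF aa (or_introl erefl))).
rewrite (cint_split cy yd (continuous_frame_vseg cF bb (or_intror erefl))); ring.
Qed.

Lemma rectint_le F a b c d k : a <= b -> c <= d -> continuous_frame F a b c d ->
  (forall z, in_frame a b c d z -> normc (F z) <= k) ->
  normc (rectint F a b c d) <= 4 * k * ((b - a) + (d - c)).
Proof.
move=> ab cd cF Fk.
have aa : a <= a <= b by rewrite lexx.
have bb : a <= b <= b by rewrite ab lexx.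
have cc : c <= c <= d by rewrite lexx.
have dd : c <= d <= d by rewrite cd lexx.
have i1 : normc ('i%C : R[i]) = 1 by rewrite /= expr0n expr1n add0r sqrtr1.
have h1 := cint_le ab (continuous_frame_hseg cF cc (or_introl erefl)) (fun x xab => Fk (x +i*
  c)%C (conj (conj xab cc) (or_intror (or_intror (or_introl erefl))))).
have h2 := cint_le ab (continuous_frame_hseg cF dd (or_intror erefl)) (fun x xab => Fk (x +i*
  d)%C (conj (conj xab dd) (or_intror (or_intror (or_intror erefl))))).
have h3 := cint_le cd (continuous_frame_vseg cF aa (or_introl erefl)) (fun y yab => Fk (a +i*
  y)%C (conj (conj aa yab) (or_introl erefl))).
have h4 := cint_le cd (continuous_frame_vseg cF bb (or_intror erefl)) (fun y yab => Fk (b +i*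
  y)%C (conj (conj bb yab) (or_intror (or_introl erefl)))).
have n3 (p q r s : R[i]) : normc (p + q - r - s) <= normc p + normc q + normc r + normc s.
  by do 3 (apply: le_trans (le_normcD _ _) _; rewrite ?normcN lerD2r).
rewrite /rectint; apply: le_trans (n3 _ _ _ _) _.
rewrite !normcM i1 !mul1r; lra.
Qed.

Lemma rectintB F G a b c d : a <= b -> c <= d ->
  continuous_frame F a b c d -> continuous_frame G a b c d ->
  rectint (fun z => F z - G z) a b c d = rectint F a b c d - rectint G a b c d.
Proof.
move=> ab cd cF cG.
have aa : a <= a <= b by rewrite lexx.
have bb : a <= b <= b by rewrite ab lexx.
have cc : c <= c <= d by rewrite lexx.
have dd : c <= d <= d by rewrite cd lexx.
rewrite /rectint (cintB (continuous_frame_hseg cF cc (or_introl erefl)) (continuous_frame_hseg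
  cG cc (or_introl erefl))).
rewrite (cintB (continuous_frame_hseg cF dd (or_intror erefl)) (continuous_frame_hseg cG dd
  (or_intror erefl))).
rewrite (cintB (continuous_frame_vseg cF aa (or_introl erefl)) (continuous_frame_vseg cG aa
  (or_introl erefl))).
rewrite (cintB (continuous_frame_vseg cF bb (or_intror erefl)) (continuous_frame_vseg cG bb
  (or_intror erefl))); ring.
Qed.

(** By direct evaluation the horizontal sides leave -il(b - a)(d - c) and the vertical ones the
    opposite. This removes the first-order Taylor part in [goursat]. *)
Lemma rectint_affine (k l : CC[R]) a b c d : a <= b -> c <= d ->
  rectint (fun z => k + l * z) a b c d = 0.
Proof.
move=> ab cd.
have hE y : cint (fun x => k + l * (x +i* y)%C : CC[R]) a b =
    (k + l * ('i%C * y%:C%C)) * (b - a)%:C%C + l * ((b ^+ 2 - a ^+ 2) / 2)%:C%C.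
  rewrite -cint_affine//; apply: eq_cint => x _.
  by rewrite [(x +i* y)%C]complexE /= mulrDr addrAC addrA.
have vE x : cint (fun y => k + l * (x +i* y)%C : CC[R]) c d =
    (k + l * x%:C%C) * (d - c)%:C%C + (l * 'i%C) * ((d ^+ 2 - c ^+ 2) / 2)%:C%C.
  rewrite -cint_affine//; apply: eq_cint => y _.
  by rewrite [(x +i* y)%C]complexE /= mulrDr addrA mulrA.
rewrite /rectint !hE !vE.
have ii := sqr_i R.
rewrite !rmorphM !rmorphB !rmorphXn /=.
have -> : (2^-1)%:C%C = 2^-1 :> R[i] by rewrite fmorphV rmorph_nat.
set A := a%:C%C; set B := b%:C%C; set C := c%:C%C; set D := d%:C%C; set I := 'i%C.
transitivity (l * (I ^+ 2 + 1) * ((D ^+ 2 - C ^+ 2) * 0)); last by rewrite !mulr0.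
ring.
Qed.

Lemma derivable_continuous F z : derivable F z 1 -> {for z, continuous F}.
Proof.
by move=> dF; apply: (@differentiable_continuous _ CC[R] CC[R]); exact/derivable1_diffP.
Qed.

Lemma derivable_normc F z : derivable F z 1 -> exists D : CC[R], forall e, 0 < e ->
  exists2 r : R, 0 < r & forall t : CC[R], normc (t - z) < r ->
    normc (F t - F z - (t - z) * D) <= e * normc (t - z).
Proof.
move=> dF; exists ('D_1 F z) => e e0.
have e0' : 0 < e%:C%C :> R[i] by rewrite ltcR.
have := @derivable_approx R[i] F z dF _ e0' => /nbhs_normcP[r r0 hr].
exists r => // y yz; have := hr (y - z); rewrite subr0 => /(_ yz).
by rewrite [z + _]addrC subrK !norm_normc -rmorphM lecR.
Qed.

(** Left ends increase and right ends decrease, so the supremum of the left ends lies in every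
    interval. *)
Lemma nested_halving (u : nat -> R) (w : R) : 0 <= w ->
  (forall n, u n <= u n.+1 <= u n + w / 2 ^+ n.+1) ->
  exists x, forall n, u n <= x <= u n + w / 2 ^+ n.
Proof.
move=> w0 hu; have w2 n : 0 <= w / 2 ^+ n by rewrite divr_ge0// exprn_ge0.
have w2S n : w / 2 ^+ n.+1 + w / 2 ^+ n.+1 = w / 2 ^+ n.
  by rewrite exprS; field; rewrite expf_neq0 ?pnatr_eq0.
have up n m : u n <= u (n + m)%N.
  elim: m => [|m IH]; first by rewrite addn0.
  by rewrite addnS (le_trans IH)//; have /andP[] := hu (n + m)%N.
have down n m : u (n + m)%N + w / 2 ^+ (n + m) <= u n + w / 2 ^+ n.
  elim: m => [|m IH]; first by rewrite addn0.
  rewrite addnS; apply: le_trans IH.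
  have /andP[_] := hu (n + m)%N; rewrite -(lerD2r (w / 2 ^+ (n + m).+1)) => /le_trans; apply.
  by rewrite -addrA w2S.
have ub n : ubound (range u) (u n + w / 2 ^+ n).
  move=> _ [m _ <-].
  have [nm|mn] := ltnP n m.
    rewrite -(subnKC (ltnW nm)); apply: le_trans (down n (m - n)%N).
    by rewrite lerDl.
  by apply: (le_trans (up m (n - m)%N)); rewrite subnKC// lerDl.
exists (sup (range u)) => n; apply/andP; split.
  by apply: ub_le_sup; [exists (u 0%N + w / 2 ^+ 0); exact: ub|exists n].
by apply: ge_sup; [exists (u n); exists n|exact: ub].
Qed.

Lemma halving_small (C r : R) : 0 < r -> exists n, C / 2 ^+ n < r.
Proof.
move=> r0; exists (Num.truncn (C / r)).+1.
have h : C / r < (Num.truncn (C / r)).+1%:R by exact: truncnS_gt.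
rewrite ltr_pdivrMr ?exprn_gt0// mulrC -ltr_pdivrMr//; apply: (lt_trans h).
by rewrite -natrX ltr_nat ltn_expl.
Qed.

End Goursat.

Section CauchyRectangle.
Context {R : realType}.
Implicit Types (F G : CC[R] -> CC[R]) (z : CC[R]) (a b c d x y k e r : R).

Lemma in_frame_rect a b c d z : in_frame a b c d z -> in_rect a b c d z.
Proof. by case. Qed.

Lemma derivable_frame F a b c d : (forall z, in_rect a b c d z -> derivable F z 1) ->
  continuous_frame F a b c d.
Proof. by move=> dF z /in_frame_rect /dF; exact: derivable_continuous. Qed.

Lemma rectint_quarters F a b c d x y : a <= x <= b -> c <= y <= d ->
  (forall z, in_rect a b c d z -> {for z, continuous F}) ->
  rectint F a b c d = (rectint F a x c y + rectint F a x y d) +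
                      (rectint F x b c y + rectint F x b y d).
Proof.
move=> /andP[ax xb] /andP[cy yd] cF.
rewrite (rectint_hsplit ax xb (le_trans cy yd)); last by move=> z /in_frame_rect /cF.
congr (_ + _); apply: rectint_vsplit => // z /in_frame_rect h; apply: cF;
  by apply: in_rect_sub h.
Qed.

(* Bisection: a rectangle with nonzero integral contains nested rectangles of
   size 2^-n whose integrals are at least 4^-n of the first one, against the
   o(2^-n) * O(2^-n) bound given by differentiability at the limit point. *)
Lemma goursat F a b c d : a <= b -> c <= d ->
  (forall z, in_rect a b c d z -> derivable F z 1) -> rectint F a b c d = 0.
Proof.
move=> ab cd dF; apply/eqP; rewrite -normc_eq0; apply/negPn/negP => n0.
have E0 : 0 < normc (rectint F a b c d) by rewrite lt_neqAle eq_sym n0 normc_ge0.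
set E := normc (rectint F a b c d) in E0 n0.
pose w := b - a; pose h := d - c.
have w0 : 0 <= w by rewrite subr_ge0.
have h0 : 0 <= h by rewrite subr_ge0.
have p2 n : 0 < (2 : R) ^+ n by rewrite exprn_gt0.
have p4 n : 0 < (4 : R) ^+ n by rewrite exprn_gt0.
pose bad n x y := [/\ a <= x /\ x + w / 2 ^+ n <= b, c <= y /\ y + h / 2 ^+ n <= d
  & E / 4 ^+ n <= normc (rectint F x (x + w / 2 ^+ n) y (y + h / 2 ^+ n))].
have step n x y : bad n x y -> exists q : R * R, [/\ bad n.+1 q.1 q.2,
    x <= q.1 <= x + w / 2 ^+ n.+1 & y <= q.2 <= y + h / 2 ^+ n.+1].
  move=> [[ax xb] [cy yd] hE].
  have w2S : w / 2 ^+ n = w / 2 ^+ n.+1 + w / 2 ^+ n.+1.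
    by rewrite exprS; field; rewrite gt_eqF.
  have h2S : h / 2 ^+ n = h / 2 ^+ n.+1 + h / 2 ^+ n.+1.
    by rewrite exprS; field; rewrite gt_eqF.
  have E4S : E / 4 ^+ n = 4 * (E / 4 ^+ n.+1) by rewrite exprS; field; rewrite gt_eqF.
  rewrite w2S h2S E4S in xb yd hE.
  have wn0 : 0 <= w / 2 ^+ n.+1 by rewrite divr_ge0// ltW.
  have hn0 : 0 <= h / 2 ^+ n.+1 by rewrite divr_ge0// ltW.
  move: xb yd hE wn0 hn0; set wn := w / 2 ^+ n.+1; set hn := h / 2 ^+ n.+1.
  move=> xb yd hE wn0 hn0.
  have cF z : in_rect x (x + (wn + wn)) y (y + (hn + hn)) z -> {for z, continuous F}.
    by move=> /(in_rect_sub ax xb cy yd) /dF; exact: derivable_continuous.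
  have xx : x <= x + wn <= x + (wn + wn) by rewrite !lerD2l !lerDl wn0.
  have yy : y <= y + hn <= y + (hn + hn) by rewrite !lerD2l !lerDl hn0.
  rewrite (rectint_quarters xx yy cF) in hE.
  rewrite (addrA x) (addrA y) in hE.
  rewrite /bad -/wn -/hn.
  have pick x' y' : x <= x' <= x + wn -> y <= y' <= y + hn ->
    E / 4 ^+ n.+1 <= normc (rectint F x' (x' + wn) y' (y' + hn)) ->
    exists q : R * R,
    [/\ [/\ a <= q.1 /\ q.1 + wn <= b, c <= q.2 /\ q.2 + hn <= d
        & E / 4 ^+ n.+1 <= normc (rectint F q.1 (q.1 + wn) q.2 (q.2 + hn))],
      x <= q.1 <= x + wn & y <= q.2 <= y + hn].
    move=> xx' yy' hq; exists (x', y'); split => //; split => //.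
      move/andP: xx' => [x1 x2]; split; first exact: le_trans x1.
      by apply: le_trans xb; rewrite addrA lerD2r.
    move/andP: yy' => [y1 y2]; split; first exact: le_trans y1.
    by apply: le_trans yd; rewrite addrA lerD2r.
  have xl : x <= x <= x + wn by rewrite lexx lerDl.
  have xr : x <= x + wn <= x + wn by rewrite lexx lerDl wn0.
  have yl : y <= y <= y + hn by rewrite lexx lerDl.
  have yr : y <= y + hn <= y + hn by rewrite lexx lerDl hn0.
  have [q1|q1] := leP (E / 4 ^+ n.+1) (normc (rectint F x (x + wn) y (y + hn))).
    exact: pick xl yl q1.
  have [q2|q2] := leP (E / 4 ^+ n.+1) (normc (rectint F x (x + wn) (y + hn) (y + hn + hn))).
    exact: pick xl yr q2.
  have [q3|q3] := leP (E / 4 ^+ n.+1) (normc (rectint F (x + wn) (x + wn + wn) y (y + hn))).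
    exact: pick xr yl q3.
  have [q4|q4] := leP (E / 4 ^+ n.+1) (normc (rectint F (x + wn) (x + wn + wn) (y + hn) (y +
    hn + hn))).
    exact: pick xr yr q4.
  exfalso; move: hE; apply/negP; rewrite -ltNge.
  have n4 (p q r s : R[i]) : normc (p + q + (r + s)) <= (normc p + normc q) + (normc r + normc
    s).
    by apply: le_trans (le_normcD _ _) _; rewrite lerD ?le_normcD.
  apply: le_lt_trans (n4 _ _ _ _) _.
  have -> : forall t : R, 4 * t = (t + t) + (t + t) by move=> t; ring.
  by apply: ltrD; apply: ltrD.
(* The choice is made total by an arbitrary value where [bad] fails, so that the sequence of corners
   can be defined by plain recursion. *)
have /choice[next hnext] : forall np : nat * (R * R), exists q : R * R,
    bad np.1 np.2.1 np.2.2 -> [/\ bad np.1.+1 q.1 q.2,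
      np.2.1 <= q.1 <= np.2.1 + w / 2 ^+ np.1.+1
    & np.2.2 <= q.2 <= np.2.2 + h / 2 ^+ np.1.+1].
  case=> n [x y]; have [nb|nb] := pselect (bad n x y); last by exists (x, y).
  by have [q hq] := step _ _ _ nb; exists q.
pose u := fix u n := if n is n'.+1 then next (n', u n') else (a, c).
have bu n : bad n (u n).1 (u n).2.
  elim: n => [|n IH]; last by have [] := hnext (n, u n) IH.
  by rewrite /bad expr0 !divr1 /w /h !subrKC.
have [x0 hx0] : exists x, forall n, (u n).1 <= x <= (u n).1 + w / 2 ^+ n.
  by apply: nested_halving => // n; have [] := hnext (n, u n) (bu n).
have [y0 hy0] : exists y, forall n, (u n).2 <= y <= (u n).2 + h / 2 ^+ n.
  by apply: nested_halving => // n; have [] := hnext (n, u n) (bu n).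
pose z0 : CC[R] := (x0 +i* y0)%C.
have z0R : in_rect a b c d z0.
  split => /=; [have := hx0 0%N|have := hy0 0%N];
  by rewrite /= expr0 divr1 /w /h subrKC.
have [D hD] := derivable_normc (dF _ z0R).
pose s := w + h; have s0 : 0 <= s by rewrite addr_ge0.
(* The final estimate reads E <= 4 e s^2; this e makes the right side at most E/2, and the summand 1
   covers s = 0. *)
have e0 : 0 < E / (8 * (s ^+ 2 + 1)).
  by rewrite divr_gt0// mulr_gt0// ltr_wpDl// sqr_ge0.
set e := E / _ in e0.
have [r r0 hr] := hD _ e0.
have [n hn] := halving_small s r0.
have [[ax xb] [cy yd] hE] := bu n; move: ax xb cy yd hE (hx0 n) (hy0 n).
set x := (u n).1; set y := (u n).2; set wn := w / 2 ^+ n; set hn' := h / 2 ^+ n.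
move=> ax xb cy yd hE hx hy.
have wn0 : 0 <= wn by rewrite divr_ge0// ltW.
have hn0 : 0 <= hn' by rewrite divr_ge0// ltW.
have snE : s / 2 ^+ n = wn + hn' by rewrite /s mulrDl.
have xw : x <= x + wn by rewrite lerDl.
have yh : y <= y + hn' by rewrite lerDl.
(* The first-order Taylor polynomial at the limit point; its boundary integral is 0. *)
pose A (t : CC[R]) : CC[R] := (F z0 - z0 * D) + D * t.
have cA t : {for t, continuous A}.
  apply: (ctsD (f := fun=> _)); first exact: cts_cst.
  by apply: (ctsM (f := fun=> D) (h := id)); [exact: cts_cst|exact: cvg_id].
have cF : continuous_frame F x (x + wn) y (y + hn').
  by apply: derivable_frame => z /(in_rect_sub ax xb cy yd) /dF.
have hB : normc (rectint (fun t => F t - A t) x (x + wn) y (y + hn')) <=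
    4 * (e * (s / 2 ^+ n)) * (x + wn - x + (y + hn' - y)).
  apply: (rectint_le xw yh).
    move=> t th; apply: (ctsD (f := F) (h := fun t => - A t)); first exact: cF.
    by apply: ctsN; exact: cA.
  move=> t /in_frame_rect[tx ty].
  have tz : normc (t - z0) <= s / 2 ^+ n.
    rewrite snE; apply: le_trans (normc_le_ReIm _) _; rewrite !raddfB /=.
    apply: lerD; rewrite ler_norml; apply/andP.
      by move/andP: tx hx => [? ?] /andP[? ?]; split; lra.
    by move/andP: ty hy => [? ?] /andP[? ?]; split; lra.
  rewrite (_ : F t - A t = F t - F z0 - (t - z0) * D); last by rewrite /A; ring.
  apply: le_trans (hr _ (le_lt_trans tz hn)) _.
  by rewrite ler_pM2l.
rewrite (rectintB xw yh cF (fun t _ => cA t)) (rectint_affine _ _ xw yh) subr0 in hB.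
have {hE} := le_trans hE hB.
rewrite [x + wn - x]addrAC subrr add0r [y + hn' - y]addrAC subrr add0r -snE.
rewrite ler_pdivrMr// (_ : _ * _ * _ * _ = 4 * e * s ^+ 2 * (4 ^+ n / (2 ^+ n * 2 ^+ n)));
  last first.
  by field; rewrite gt_eqF.
rewrite -exprMn -natrM divff ?gt_eqF// mulr1.
rewrite (_ : 4 * e * s ^+ 2 = E * (s ^+ 2 / (2 * (s ^+ 2 + 1)))); last first.
  by rewrite /e; field; rewrite gt_eqF// ltr_wpDl// sqr_ge0.
have s20 : 0 <= s ^+ 2 by rewrite sqr_ge0.
rewrite ler_pMr// ler_pdivlMr ?mulr_gt0 ?ltr_wpDl//; lra.
Qed.

End CauchyRectangle.

Section CauchyPole.
Context {R : realType}.
Implicit Types (F G : CC[R] -> CC[R]) (z t : CC[R]) (a b c d x y k e r : R).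

Lemma rectintZ F (k : CC[R]) a b c d : a <= b -> c <= d -> continuous_frame F a b c d ->
  rectint (fun z => k * F z) a b c d = k * rectint F a b c d.
Proof.
move=> ab cd cF.
have aa : a <= a <= b by rewrite lexx.
have bb : a <= b <= b by rewrite ab lexx.
have cc : c <= c <= d by rewrite lexx.
have dd : c <= d <= d by rewrite cd lexx.
rewrite /rectint (cintZ _ (continuous_frame_hseg cF cc (or_introl erefl))).
rewrite (cintZ _ (continuous_frame_hseg cF dd (or_intror erefl))).
rewrite (cintZ _ (continuous_frame_vseg cF aa (or_introl erefl))).
rewrite (cintZ _ (continuous_frame_vseg cF bb (or_intror erefl))); ring.
Qed.

Lemma arctan_kernel_continuous x r s : 0 < r ->
  {for s, continuous (fun s => 2 * r / (r ^+ 2 + (s - x) ^+ 2))}.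
Proof.
move=> r0; have dn : r ^+ 2 + (s - x) ^+ 2 != 0.
  by rewrite gt_eqF// ltr_pwDl ?exprn_gt0// sqr_ge0.
apply: (@cvgM _ _ (nbhs s)); first exact: cvg_cst.
apply: (@cvgV _ _ (nbhs s)); first exact: dn.
apply: (@cvgD _ _ _ (nbhs s)); first exact: cvg_cst.
have ct : (fun s => s - x) @ s --> s - x.
  by apply: (@cvgB _ _ _ (nbhs s)); [exact: cvg_id|exact: cvg_cst].
by rewrite (_ : (fun s => _) = fun s => (s - x) * (s - x)) //; apply: (@cvgM _ _ (nbhs s)).
Qed.

(** The primitive 2 atan((s - x)/r) runs from -pi/2 to pi/2. Two such integrals make up the integral
    of a simple pole over a centred square. *)
Lemma rint_arctan x r : 0 < r ->
  rint (fun s => 2 * r / (r ^+ 2 + (s - x) ^+ 2)) (x - r) (x + r) = pi.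
Proof.
move=> r0; have r20 : 0 < r ^+ 2 by rewrite exprn_gt0.
have dn (s : R) : r ^+ 2 + (s - x) ^+ 2 != 0 by rewrite gt_eqF// ltr_pwDl// sqr_ge0.
transitivity (2 * atan ((x + r - x) / r) - 2 * atan ((x - r - x) / r)); last first.
  rewrite addrAC subrr add0r divff ?gt_eqF// addrAC subrr add0r mulNr divff ?gt_eqF//.
  by rewrite atanN atan1; field.
apply: (@rint_FTC _ (fun s => 2 * atan ((s - x) / r))).
- by rewrite lerD2l; lra.
- move=> s; have -> : 2 * r / (r ^+ 2 + (s - x) ^+ 2) = 2 *: ((1 + ((s - x) / r) ^+ 2)^-1 *
  r^-1).
    rewrite -[_ *: _]/(_ * _); by field; rewrite dn andbT gt_eqF.
  have dl : is_derive s 1 (fun s : R => (s - x) / r) r^-1.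
    by apply: is_derive_eq; rewrite scaler0 add0r subr0 [_ *: _]mulr1.
  have D1 := is_derive1_comp (is_derive1_atan _) dl.
  have D2 := is_deriveZ 2 D1; exact D2.
by move=> s _; exact: arctan_kernel_continuous.
Qed.

Lemma cint_realfun (f : R -> R) a b : a <= b ->
  cint (fun x => (f x)%:C%C) a b = (rint f a b)%:C%C.
Proof. by move=> ab; rewrite /cint rint_cst// mul0r. Qed.

Lemma pole_continuous z t : t != z -> {for t, continuous (fun t : CC[R] => (t - z)^-1 :
  CC[R])}.
Proof.
move=> tz; apply: (ctsV (f := fun t => t - z)); first by rewrite subr_eq0.
by apply: (ctsD (f := id)); [exact: cvg_id|exact: cts_cst].
Qed.

Lemma in_frame_neq a b c d z t : a < complex.Re z < b -> c < complex.Im z < d ->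
  in_frame a b c d t -> t != z.
Proof.
move=> /andP[h1 h2] /andP[h3 h4] [_ ht]; apply/eqP => tz; move: ht h1 h2 h3 h4.
by rewrite tz => -[->|[->|[->|->]]]; rewrite ltxx.
Qed.

Lemma in_square z r : 0 < r ->
  [/\ complex.Re z - r < complex.Re z < complex.Re z + r,
      complex.Im z - r < complex.Im z < complex.Im z + r,
      complex.Re z - r <= complex.Re z + r & complex.Im z - r <= complex.Im z + r].
Proof. by move=> r0; split; try (apply/andP; split); lra. Qed.

(** Opposite sides are paired: 1/(u - ir) - 1/(u + ir) = 2ir/(r^2 + u^2), and 1/(r + iu) + 1/(r -
    iu) = 2r/(r^2 + u^2). Each pair contributes pi i through the arctangent kernel, with no branch
    of the logarithm. *)
Lemma rectint_pole z r : 0 < r ->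
  rectint (fun t => (t - z)^-1) (complex.Re z - r) (complex.Re z + r)
    (complex.Im z - r) (complex.Im z + r) = 2 * pi%:C%C * 'i%C.
Proof.
move=> r0; have [zx zy xx yy] := in_square z r0.
have cF : continuous_frame (fun t => (t - z)^-1) (complex.Re z - r) (complex.Re z + r)
    (complex.Im z - r) (complex.Im z + r).
  by move=> t /(in_frame_neq zx zy); exact: pole_continuous.
move: zx zy xx yy cF; case: z => x0 y0; rewrite ![complex.Re _]/= ![complex.Im _]/=.
move=> /andP[x1 x2] /andP[y1 y2] xx yy cF.
pose k x s := 2 * r / (r ^+ 2 + (s - x) ^+ 2).
have ck x a b : continuous_itv (fun s => (k x s)%:C%C : CC[R]) a b.
  move=> s _; apply: (@cvg_ReIm _ _ (nbhs s)); last exact: cvg_cst.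
  exact: arctan_kernel_continuous.
have kE (u : R) x s : u = s - x -> (k x s)%:C%C = 2 * r%:C%C / (r%:C%C ^+ 2 + u%:C%C ^+ 2) :>
  R[i].
  move=> ->; rewrite /k rmorphM fmorphV rmorphD !rmorphXn rmorphM; congr (_ * _ / _).
  by rewrite rmorph_nat.
have n0 (u : R) : r%:C%C ^+ 2 + u%:C%C ^+ 2 != 0 :> R[i].
  rewrite -!rmorphXn -rmorphD; apply/eqP => /complexI /eqP.
  by rewrite gt_eqF// ltr_pwDl ?exprn_gt0// sqr_ge0.
have ii := sqr_i R.
have subV (p q : R[i]) : p != 0 -> q != 0 -> p^-1 - q^-1 = (q - p) / (p * q).
  by move=> p0 q0; field; rewrite p0 q0.
have addV (p q : R[i]) : p != 0 -> q != 0 -> q^-1 + p^-1 = (p + q) / (p * q).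
  by move=> p0 q0; field; rewrite p0 q0.
have hsum : cint (fun x => ((x +i* (y0 - r))%C - (x0 +i* y0)%C)^-1) (x0 - r) (x0 + r)
    - cint (fun x => ((x +i* (y0 + r))%C - (x0 +i* y0)%C)^-1) (x0 - r) (x0 + r)
    = 'i%C * pi%:C%C.
  rewrite -(cintB (continuous_frame_hseg cF _ (or_introl erefl))
    (continuous_frame_hseg cF _ (or_intror erefl))); [|lra|lra].
  rewrite -(rint_arctan x0 r0) -cint_realfun// -cintZ; last exact: ck.
  apply: eq_cint => x _; rewrite (@kE (x - x0))//.
  have -> : ((x +i* (y0 - r))%C - (x0 +i* y0)%C) = (x - x0)%:C%C - 'i%C * r%:C%C.
    by apply/eqP; rewrite eq_complex /=; apply/andP; split; apply/eqP; ring.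
  have -> : ((x +i* (y0 + r))%C - (x0 +i* y0)%C) = (x - x0)%:C%C + 'i%C * r%:C%C.
    by apply/eqP; rewrite eq_complex /=; apply/andP; split; apply/eqP; ring.
  move: (n0 (x - x0)); set u := (x - x0)%:C%C; set q := r%:C%C => nu.
  have pq : (u - 'i%C * q) * (u + 'i%C * q) = q ^+ 2 + u ^+ 2.
    by rewrite -subr_sqr exprMn ii mulN1r opprK addrC.
  have := nu; rewrite -pq mulf_eq0 negb_or => /andP[nu1 nu2].
  by rewrite subV// mulrA; congr (_ / _); ring.
have vsum : cint (fun y => (((x0 + r) +i* y)%C - (x0 +i* y0)%C)^-1) (y0 - r) (y0 + r)
    - cint (fun y => (((x0 - r) +i* y)%C - (x0 +i* y0)%C)^-1) (y0 - r) (y0 + r)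
    = pi%:C%C.
  rewrite -(cintB (continuous_frame_vseg cF _ (or_intror erefl))
    (continuous_frame_vseg cF _ (or_introl erefl))); [|lra|lra].
  rewrite -(rint_arctan y0 r0) -cint_realfun//.
  apply: eq_cint => y _; rewrite (@kE (y - y0))//.
  have -> : (((x0 + r) +i* y)%C - (x0 +i* y0)%C) = r%:C%C + 'i%C * (y - y0)%:C%C.
    by apply/eqP; rewrite eq_complex /=; apply/andP; split; apply/eqP; ring.
  have -> : (((x0 - r) +i* y)%C - (x0 +i* y0)%C) = - (r%:C%C - 'i%C * (y - y0)%:C%C).
    by apply/eqP; rewrite eq_complex /=; apply/andP; split; apply/eqP; ring.
  move: (n0 (y - y0)); set u := (y - y0)%:C%C; set q := r%:C%C => nu.
  have pq : (q - 'i%C * u) * (q + 'i%C * u) = q ^+ 2 + u ^+ 2.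
    by rewrite -subr_sqr exprMn ii mulN1r opprK.
  have := nu; rewrite -pq mulf_eq0 negb_or => /andP[nu1 nu2].
  by rewrite invrN opprK addV//; congr (_ / _); ring.
rewrite /rectint.
set h1 := cint _ _ _ in hsum *; set h2 := cint _ _ _ in hsum *.
set v1 := cint _ _ _ in vsum *; set v2 := cint _ _ _ in vsum *.
transitivity ((h1 - h2) + 'i%C * (v1 - v2)); first by ring.
by rewrite hsum vsum; ring.
Qed.

End CauchyPole.

(** * Cauchy's formula on rectangles *)

Section CauchyFormula.
Context {R : realType}.
Implicit Types (F : CC[R] -> CC[R]) (z t : CC[R]) (a b c d x y k e r : R).

Lemma derivable_div F z t : t != z -> derivable F t 1 ->
  derivable (fun t : CC[R] => F t / (t - z) : CC[R]) t 1.
Proof.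
move=> tz dF; have dB : derivable (fun t : CC[R] => t - z : CC[R]) t 1.
  by apply: derivableB; [exact: derivable_id|exact: derivable_cst].
have t0 : t - z != 0 by rewrite subr_eq0.
exact: (@derivableM R[i] CC[R] F (fun t => (t - z)^-1) t 1 dF
  (@derivableV R[i] CC[R] (fun t => t - z) t 1 t0 dB)).
Qed.

Lemma in_frame_square_dist z r t : 0 < r ->
  in_frame (complex.Re z - r) (complex.Re z + r) (complex.Im z - r) (complex.Im z + r) t ->
  r <= normc (t - z) <= 2 * r.
Proof.
move=> r0 [[/andP[t1 t2] /andP[t3 t4]] hh].
have hr := ler_normc_Re (t - z); have hi := ler_normc_Im (t - z).
have ht := normc_le_ReIm (t - z); rewrite !raddfB /= in hr hi ht.
have a1 : `|complex.Re t - complex.Re z| <= r by rewrite ler_distl t1.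
have a2 : `|complex.Im t - complex.Im z| <= r by rewrite ler_distl t3.
apply/andP; split; last first.
  by apply: le_trans ht _; rewrite mulr_natl mulr2n lerD.
case: hh => [h|[h|[h|h]]].
- by apply: le_trans hr; rewrite h addrAC subrr add0r normrN ler_norm.
- by apply: le_trans hr; rewrite h addrAC subrr add0r ler_norm.
- by apply: le_trans hi; rewrite h addrAC subrr add0r normrN ler_norm.
- by apply: le_trans hi; rewrite h addrAC subrr add0r ler_norm.
Qed.

(* Only the value of the integral over arbitrarily small squares around the
   pole matters, so continuity of [F] at [z] suffices there. *)
Lemma cauchy_rect F a b c d z :
  a < complex.Re z < b -> c < complex.Im z < d ->
  (forall t, in_rect a b c d t -> derivable F t 1) ->
  rectint (fun t => F t / (t - z)) a b c d = 2 * pi%:C%C * 'i%C * F z.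
Proof.
move=> abz cdz dF; move/andP: (abz) => [az zb]; move/andP: (cdz) => [cz zd].
have ab : a <= b by rewrite ltW// (lt_trans az).
have cd : c <= d by rewrite ltW// (lt_trans cz).
pose q t : CC[R] := F t / (t - z).
have cq t : in_rect a b c d t -> t != z -> {for t, continuous q}.
  by move=> ht tz; exact: derivable_continuous (derivable_div tz (dF t ht)).
have Rz : in_rect a b c d z by split; apply/andP; split; apply: ltW.
(* Four cuts detach strips that avoid z; [goursat] kills each of them and leaves the small
   square. *)
have shrink r : 0 < r -> a <= complex.Re z - r -> complex.Re z + r <= b ->
    c <= complex.Im z - r -> complex.Im z + r <= d ->
    rectint q a b c d = rectint q (complex.Re z - r) (complex.Re z + r)
                                  (complex.Im z - r) (complex.Im z + r).
  move=> r0 h1 h2 h3 h4; have [zx zy xx yy] := in_square z r0.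
  move/andP: (zx) => [x1 x2]; move/andP: (zy) => [y1 y2].
  have frame a' b' c' d' : a <= a' -> b' <= b -> c <= c' -> d' <= d ->
      a' < complex.Re z < b' -> c' < complex.Im z < d' -> continuous_frame q a' b' c' d'.
    move=> ha hb hc hd zx' zy' t ht; apply: cq; last exact: in_frame_neq ht.
    exact: in_rect_sub (in_frame_rect ht).
  have off a' b' c' d' : a <= a' -> b' <= b -> c <= c' -> d' <= d ->
      a' <= b' -> c' <= d' -> (forall t, in_rect a' b' c' d' t -> t != z) ->
      rectint q a' b' c' d' = 0.
    move=> ha hb hc hd ab' cd' tz; apply: (goursat ab' cd') => t ht.
    exact: derivable_div (tz t ht) (dF t (in_rect_sub ha hb hc hd ht)).
  have out a' b' c' d' : [\/ complex.Re z < a', b' < complex.Re z, complex.Im z < c'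
      | d' < complex.Im z] -> forall t, in_rect a' b' c' d' t -> t != z.
    move=> h t [/andP[t1 t2] /andP[t3 t4]]; apply/eqP => tz; move: h t1 t2 t3 t4.
    by rewrite tz => -[] h *; lra.
  have la : a <= a by []. have lb : b <= b by []. have lc : c <= c by [].
  have ld : d <= d by [].
  have zb' := lt_le_trans x2 h2; have zd' := lt_le_trans y2 h4.
  have az' := le_lt_trans h1 x1; have cz' := le_lt_trans h3 y1.
  have xb := le_trans xx h2; have yd := le_trans yy h4.
  have ax := le_trans h1 xx; have cy := le_trans h3 yy.
  rewrite (rectint_hsplit h1 xb cd); last by apply: frame => //; apply/andP.
  rewrite (off _ _ _ _ la xb lc ld h1 cd); last by apply: out; apply: Or42.
  rewrite add0r (rectint_hsplit xx h2 cd); last by apply: frame => //; apply/andP.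
  rewrite (off _ _ _ _ ax lb lc ld h2 cd); last by apply: out; apply: Or41.
  rewrite addr0 (rectint_vsplit h3 yd xx); last by apply: frame => //; apply/andP.
  rewrite (off _ _ _ _ h1 h2 lc yd xx h3); last by apply: out; apply: Or44.
  rewrite add0r (rectint_vsplit yy h4 xx); last by apply: frame => //; apply/andP.
  rewrite (off _ _ _ _ h1 h2 cy ld xx h4); last by apply: out; apply: Or43.
  by rewrite addr0.
apply/eqP; rewrite -subr_eq0 -normc_eq0; apply/negPn/negP => n0.
set X := rectint _ a b c d - _ in n0.
have E0 : 0 < normc X by rewrite lt_neqAle eq_sym n0 normc_ge0.
(* On the square of half-side r, [rectint_le] contributes 4 times 4r against a bound |X|/(32 r): in
   all |X|/2, a contradiction. *)
have e0 : 0 < normc X / 32 by rewrite divr_gt0.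
have [D D0 hD] := (cts_normcP F z).1 (derivable_continuous (dF _ Rz)) _ e0.
(* The first four bounds keep the square inside the rectangle; D/4 keeps its frame, at distance at
   most 2r from z, within D. *)
pose r := Num.min (Num.min (complex.Re z - a) (b - complex.Re z))
   (Num.min (Num.min (complex.Im z - c) (d - complex.Im z)) (D / 4)).
have : 0 < r by rewrite !lt_min !subr_gt0 az zb cz zd divr_gt0.
have : r <= complex.Re z - a by rewrite !ge_min lexx.
have : r <= b - complex.Re z by rewrite !ge_min lexx ?orbT.
have : r <= complex.Im z - c by rewrite !ge_min lexx ?orbT.
have : r <= d - complex.Im z by rewrite !ge_min lexx ?orbT.
have : r <= D / 4 by rewrite !ge_min lexx ?orbT.
move: r => r rD r4 r3 r2 r1 r0.
have {}r1 : a <= complex.Re z - r by rewrite lerBrDr addrC -lerBrDr.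
have {}r2 : complex.Re z + r <= b by rewrite addrC -lerBrDr.
have {}r3 : c <= complex.Im z - r by rewrite lerBrDr addrC -lerBrDr.
have {}r4 : complex.Im z + r <= d by rewrite addrC -lerBrDr.
have [zx zy xx yy] := in_square z r0.
have cS t : in_frame (complex.Re z - r) (complex.Re z + r) (complex.Im z - r)
    (complex.Im z + r) t -> {for t, continuous q}.
  move=> ht; apply: cq; last exact: in_frame_neq ht.
  by apply: in_rect_sub (in_frame_rect ht).
have cP t : in_frame (complex.Re z - r) (complex.Re z + r) (complex.Im z - r)
    (complex.Im z + r) t -> {for t, continuous (fun t : CC[R] => (t - z)^-1 : CC[R])}.
  by move=> ht; apply: pole_continuous; exact: in_frame_neq ht.
have XE : X = rectint (fun t => q t - F z * (t - z)^-1) (complex.Re z - r)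
    (complex.Re z + r) (complex.Im z - r) (complex.Im z + r).
  have cFP := fun t ht => ctsM (@cts_cst R (F z) t) (cP t ht).
  rewrite (rectintB xx yy cS cFP) (rectintZ _ xx yy cP) (rectint_pole _ r0).
  by rewrite /X (@shrink r) 1?[F z * _]mulrC.

have : normc X <= 4 * (normc X / 32 / r) * (complex.Re z + r - (complex.Re z - r) +
    (complex.Im z + r - (complex.Im z - r))).
  rewrite {1}XE; apply: (rectint_le xx yy).
    move=> t ht; apply: (ctsD (f := q) (h := fun t => - (F z * (t - z)^-1))).
      exact: cS.
    by apply: ctsN; apply: (ctsM (f := fun=> F z)); [exact: cts_cst|exact: cP].
  move=> t ht; rewrite /q -mulrBl normcM normcV.
  have /andP[tr t2r] := in_frame_square_dist r0 ht.
  have td : normc (t - z) < D.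
    apply: le_lt_trans t2r _; rewrite -ltr_pdivlMl//; apply: le_lt_trans rD _.
    by rewrite [2^-1 * _]mulrC ltr_pM2l// ltf_pV2 ?posrE// ltr_nat.
  apply: ler_pM; rewrite ?invr_ge0 ?normc_ge0//; first exact: ltW (hD _ td).
  by rewrite lef_pV2 ?posrE// (lt_le_trans r0).
rewrite (_ : _ * _ * _ = normc X / 2); last by field; rewrite gt_eqF.
lra.
Qed.

End CauchyFormula.

(** * Runge's theorem *)

Section RationalApproximation.
Context {R : realType}.
Implicit Types (K : set CC[R]) (f h : CC[R] -> CC[R]) (z w : CC[R]) (a b x y e : R).

(** The sign [q.2 - z] is that of Cauchy's kernel: these sums arise as Riemann sums of Cauchy
    integrals. *)
Definition simple_fractions (s : seq (CC[R] * CC[R])) z : CC[R] :=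
  \sum_(q <- s) q.1 / (q.2 - z).

Definition rapprox K f := forall e, 0 < e ->
  exists2 s : seq (CC[R] * CC[R]), (forall q, q \in s -> ~ K q.2) &
    forall z, K z -> normc (f z - simple_fractions s z) <= e.

Lemma eq_rapprox K f h : (forall z, K z -> f z = h z) -> rapprox K f -> rapprox K h.
Proof.
move=> fh rf e /rf[s s1 s2]; exists s => // z Kz.
by rewrite -fh//; exact: s2.
Qed.

Lemma rapprox0 K : rapprox K (fun=> 0).
Proof.
move=> e e0; exists [::] => // z _.
by rewrite /simple_fractions big_nil subr0 normc0 ltW.
Qed.

Lemma rapproxD K f h : rapprox K f -> rapprox K h -> rapprox K (fun z => f z + h z).
Proof.
move=> rf rh e e0; have e2 : 0 < e / 2 by rewrite divr_gt0.
have [s1 k1 h1] := rf _ e2; have [s2 k2 h2] := rh _ e2; exists (s1 ++ s2).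
  by move=> q; rewrite mem_cat => /orP[/k1|/k2].
move=> z Kz; rewrite /simple_fractions big_cat opprD addrACA [e]splitr.
by apply: le_trans (le_normcD _ _) _; rewrite lerD ?h1 ?h2.
Qed.

Lemma rapproxZ K f (c : CC[R]) : rapprox K f -> rapprox K (fun z => c * f z).
Proof.
move=> rf e e0; have c1 : 0 < normc c + 1 by rewrite ltr_wpDl ?normc_ge0.
have [s k1 h1] := rf _ (divr_gt0 e0 c1); exists [seq (c * q.1, q.2) | q <- s].
  by move=> _ /mapP[q /k1 ? ->].
move=> z Kz; have -> : simple_fractions [seq (c * q.1, q.2) | q <- s] z =
    c * simple_fractions s z.
  by rewrite /simple_fractions big_map mulr_sumr; apply: eq_bigr => q _; rewrite mulrA.
rewrite -mulrBr normcM; apply: (@le_trans _ _ (normc c * (e / (normc c + 1)))).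
  by rewrite ler_wpM2l ?normc_ge0// h1.
by rewrite mulrCA ler_piMr ?ltW// ltr_pdivrMr// mul1r ltrDl.
Qed.

Lemma rapprox_sum K (I : Type) (r : seq I) (F : I -> CC[R] -> CC[R]) :
  (forall i, rapprox K (F i)) -> rapprox K (fun z => \sum_(i <- r) F i z).
Proof.
move=> rF; elim: r => [|i r IH].
  by apply: eq_rapprox (rapprox0 K) => z _; rewrite big_nil.
by apply: eq_rapprox (rapproxD (rF i) IH) => z _; rewrite big_cons.
Qed.

Lemma cint_chain (u : R -> CC[R]) (x : nat -> R) N :
  (forall j, x j <= x j.+1) -> continuous_itv u (x 0%N) (x N) ->
  cint u (x 0%N) (x N) = \sum_(j < N) cint u (x j) (x j.+1).
Proof.
move=> xS; have xm i j : (i <= j)%N -> x i <= x j.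
  by move=> /subnKC <-; elim: (j - i)%N => [|k IH]; rewrite ?addn0// addnS (le_trans IH).
elim: N => [|N IH] cu.
  by rewrite big_ord0 /cint /rint !set_itv1 !Rintegral_set1.
rewrite big_ord_recr /= -IH; first by apply: cint_split => //; exact: xm.
exact: continuous_itv_sub (xS N) cu.
Qed.

Section Cauchy_kernel.
Variables (phi zeta : R -> CC[R]) (a b : R).
Hypothesis cphi : continuous_itv phi a b.
Hypothesis czeta : continuous_itv zeta a b.

Let Q x z : CC[R] := phi x / (zeta x - z).

(** Joint continuity in parameter and point. Once [zeta y - w] is closer to [zeta x - z] than the
    modulus of the latter, it cannot vanish. *)
Lemma kernel_near x z e : a <= x <= b -> zeta x != z -> 0 < e ->
  exists2 d : R, 0 < d & forall y w, `|y - x| < d -> normc (w - z) < d ->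
    normc (Q y w - Q x z) < e /\ zeta y != w.
Proof.
move=> xab xz e0.
have c1 : (fun p : R * CC[R] => zeta p.1 - p.2) p @[p --> nbhs (x, z)] --> zeta x - z.
  apply: (@cvgB R[i] CC[R] _ (nbhs (x, z))); last exact: cvg_snd.
  exact: (@cvg_comp _ _ _ (fun p : R * CC[R] => p.1) zeta _ _ _ cvg_fst (czeta xab)).
have xz0 : zeta x - z != 0 by rewrite subr_eq0.
have c2 : (fun p : R * CC[R] => Q p.1 p.2) p @[p --> nbhs (x, z)] --> Q x z.
  apply: (@cvgM R[i] _ (nbhs (x, z))).
    exact: (@cvg_comp _ _ _ (fun p : R * CC[R] => p.1) phi _ _ _ cvg_fst (cphi xab)).
  exact: (@cvgV R[i] _ (nbhs (x, z)) _ _ _ xz0 c1).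
have N0 : 0 < normc (zeta x - z) by rewrite normc_gt0.
have P1 := (cvg_normcP (F := nbhs (x, z)) _ _).1 c1.
have P2 := (cvg_normcP (F := nbhs (x, z)) _ _).1 c2.
have {}P1 := P1 (nbhs_filter _) _ N0; have {}P2 := P2 (nbhs_filter _) _ e0.
have [[U V] /= [nU nV] UV] := filterI P1 P2.
have [d1 d10 hU] := (@nbhs_normP R R^o x U).1 nU.
have [d2 d20 hV] := (nbhs_normcP z V).1 nV.
exists (Num.min d1 d2); first by rewrite lt_min d10.
move=> y w; rewrite !lt_min => /andP[y1 _] /andP[_ w2].
have Uy : U y by apply: hU; rewrite /ball_/= distrC.
have [h1 h2] := UV (y, w) (conj Uy (hV _ w2)); split; first exact: h2.
apply/eqP => yw; move: h1; rewrite /= yw subrr sub0r normcN.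
by rewrite ltxx.
Qed.

Lemma cauchy_kernel_continuous z : (forall x, a <= x <= b -> zeta x != z) ->
  continuous_itv (fun x => Q x z) a b.
Proof.
move=> hz; apply: (continuous_itvM cphi); apply: continuous_itvV.
  exact: continuous_itvD czeta (@continuous_itv_cst _ (- z) a b).
by move=> x /hz; rewrite subr_eq0.
Qed.

Lemma cauchy_integral_continuous z : a <= b -> (forall x, a <= x <= b -> zeta x != z) ->
  {for z, continuous (fun z => cint (fun x => Q x z) a b)}.
Proof.
move=> ab hz; apply/cts_normcP => e e0.
have e1 : 0 < e / (2 * (b - a) + 1).
  by rewrite divr_gt0// ltr_wpDl// mulr_ge0// subr_ge0.
(* The condition [zeta x != w] travels with the estimate, so one compactness argument yields
   both. *)
have [d d0 hd] : exists2 d : R, 0 < d & forall x : R, `[a, b]%classic x ->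
    forall w, normc (w - z) < d ->
    normc (Q x w - Q x z) <= e / (2 * (b - a) + 1) /\ (a <= x <= b -> zeta x != w).
  apply: (compact_uniform (P := fun d x => forall w, normc (w - z) < d ->
    normc (Q x w - Q x z) <= e / (2 * (b - a) + 1) /\ (a <= x <= b -> zeta x != w))
    (@segment_compact R a b)).
    by move=> d d' x dd h w wz; apply: h; exact: lt_le_trans wz dd.
  move=> x; rewrite /= in_itv/= => xab.
  have e2 : 0 < e / (2 * (b - a) + 1) / 2 by rewrite divr_gt0.
  have [d d0 hd] := kernel_near xab (hz x xab) e2.
  exists d => //; apply/(@nbhs_normP R R^o); exists d => //= y; rewrite /ball_/= distrC => yx
    w wz.
  have [h1 h2] := hd y w yx wz; split => //.
  have zz : normc (z - z) < d by rewrite subrr normc0.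
  have [h3 _] := hd y z yx zz.
  apply: ltW; apply: le_lt_trans (ler_normc_dist _ (Q x z) _) _.
  by rewrite (splitr (e / _)) ltrD// normcB.
exists d => // w wz; have hw x : a <= x <= b -> zeta x != w.
  move=> xab; have [] := hd x _ w wz; first by rewrite /= in_itv.
  by move=> _; apply.
rewrite -(cintB (cauchy_kernel_continuous hw) (cauchy_kernel_continuous hz)).
apply: le_lt_trans (cint_le ab _ (k := e / (2 * (b - a) + 1)) _) _.
- have cw := cauchy_kernel_continuous hw; have cz := cauchy_kernel_continuous hz.
  exact: continuous_itvD cw (continuous_itvN cz).
- by move=> x xab; have [] := hd x _ w wz; first by rewrite /= in_itv.
have p0 : 0 < 2 * (b - a) + 1 by rewrite ltr_wpDl// mulr_ge0// subr_ge0.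
rewrite mulrAC mulrA [2 * _ * e]mulrC -mulrA gtr_pMr//.
by rewrite ltr_pdivrMr// mul1r ltrDl.
Qed.

(** Riemann sums of a Cauchy integral are sums of simple fractions with poles on the path.
    Compactness of [a, b] x K gives a mesh valid for all z at once; the factor 2 in e' is that of
    [cint_le]. *)
Lemma rapprox_cint K : a <= b -> compact K -> (forall x, a <= x <= b -> ~ K (zeta x)) ->
  rapprox K (fun z => cint (fun x => Q x z) a b).
Proof.
move=> ab cK hK e e0.
have hz x z : a <= x <= b -> K z -> zeta x != z.
  by move=> xab Kz; apply: contra_notN (hK x xab) => /eqP ->.
have p0 : 0 < 2 * (b - a) + 1 by rewrite ltr_wpDl// mulr_ge0// subr_ge0.
have e1 : 0 < e / (2 * (b - a) + 1) by rewrite divr_gt0.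
set e' := e / _ in e1.
have [d d0 hd] : exists2 d : R, 0 < d & forall p : R * CC[R], (`[a, b] `*` K) p ->
    forall y, `|p.1 - y| < d -> normc (Q p.1 p.2 - Q y p.2) <= e'.
  apply: (compact_uniform (P := fun d p => forall y, `|p.1 - y| < d ->
    normc (Q p.1 p.2 - Q y p.2) <= e')
    (compact_setX (@segment_compact R a b) cK)).
    by move=> d d' p dd h y hy; apply: h; exact: lt_le_trans hy dd.
  move=> [x z] [/=]; rewrite in_itv/= => xab Kz.
  have e2 : 0 < e' / 2 by rewrite divr_gt0.
  have [d d0 hd] := kernel_near xab (hz x z xab Kz) e2.
  exists (d / 2); first by rewrite divr_gt0.
  exists ([set y : R | `|x - y| < d / 2], [set w | normc (w - z) < d]) => /=.
    split; first by apply/(@nbhs_normP R R^o); exists (d / 2) => //=; rewrite divr_gt0.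
    by apply/nbhs_normcP; exists d.
  move=> [y w] /= [xy wz] v yv.
  have [h1 _] : normc (Q y w - Q x z) < e' / 2 /\ zeta y != w.
    apply: hd => //; rewrite distrC (lt_trans xy)// ltr_pdivrMr// ltr_pMr// ltr1n.
    by [].
  have [h2 _] : normc (Q v w - Q x z) < e' / 2 /\ zeta v != w.
    apply: hd => //; rewrite distrC; apply: le_lt_trans (ler_distD y _ _) _.
    by rewrite [d]splitr ltrD.
  apply: ltW; apply: le_lt_trans (ler_normc_dist _ (Q x z) _) _.
  by rewrite (splitr e') ltrD// normcB.
pose N := (Num.truncn ((b - a) / d)).+1.
have N0 : (0 : R) < N%:R by rewrite ltr0n.
have hN : (b - a) / N%:R < d.
  by rewrite ltr_pdivrMr// mulrC -ltr_pdivrMr// truncnS_gt.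
pose x j : R := a + (b - a) * j%:R / N%:R.
have xSE j : x j.+1 - x j = (b - a) / N%:R.
  by rewrite /x -[j.+1]addn1 natrD; field; rewrite gt_eqF.
have dx0 : 0 <= (b - a) / N%:R by rewrite divr_ge0// subr_ge0.
have xS j : x j <= x j.+1 by rewrite -subr_ge0 xSE.
have x0 : x 0%N = a by rewrite /x mulr0 mul0r addr0.
have xN : x N = b by rewrite /x mulfK ?gt_eqF// subrKC.
have xm i j : (i <= j)%N -> x i <= x j.
  by move=> /subnKC <-; elim: (j - i)%N => [|k IH]; rewrite ?addn0// addnS (le_trans IH).
have xab j : (j <= N)%N -> a <= x j <= b.
  by move=> jN; rewrite -x0 -xN !xm.
exists [seq (phi (x j) * ((b - a) / N%:R)%:C%C, zeta (x j)) | j <- iota 0 N].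
  move=> _ /mapP[j + ->] /=; rewrite mem_iota add0n => /andP[_ jN].
  by apply/hK/xab/ltnW.
move=> z Kz; have hzz y : a <= y <= b -> zeta y != z by move=> /hz; exact.
have cQ := cauchy_kernel_continuous hzz.
rewrite /simple_fractions big_map -[iota 0 N]/(index_iota 0 N) big_mkord.
rewrite -{1}x0 -{1}xN cint_chain //; last by rewrite x0 xN.
rewrite -sumrB; apply: (@le_trans _ _ (\sum_(j < N) (2 * e' * ((b - a) / N%:R)))); last first.
  rewrite sumr_const card_ord.
  have -> : (2 * e' * ((b - a) / N%:R)) *+ N = e * (2 * (b - a) / (2 * (b - a) + 1)).
    by rewrite -mulr_natr /e'; field; rewrite gt_eqF//= gt_eqF.
  by rewrite ler_piMr ?ltW// ltr_pdivrMr// mul1r ltrDl.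
apply: le_trans (ler_normc_sum _ _ _) _; apply: ler_sum => j _ /=.
have /andP[xj0 _] := xab j (ltnW (ltn_ord j)); have /andP[_ xj1] := xab j.+1 (ltn_ord j).
have cQj := continuous_itv_sub xj0 xj1 cQ.
have cC := @continuous_itv_cst R (Q (x j) z) (x j) (x j.+1).
have -> : phi (x j) * ((b - a) / N%:R)%:C%C / (zeta (x j) - z) =
    cint (fun=> Q (x j) z) (x j) (x j.+1).
  by rewrite cint_cst// xSE /Q mulrAC.
rewrite -(cintB cQj cC) -(xSE j); apply: (cint_le (xS j)).
  exact: continuous_itvD cQj (continuous_itvN cC).
move=> y /andP[y1 y2]; apply: (hd (y, z)) => /=.
  by split => //=; rewrite in_itv/= (le_trans xj0 y1) (le_trans y2 xj1).
rewrite ger0_norm ?subr_ge0//; apply: le_lt_trans hN.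
by rewrite -(xSE j) lerD2r.
Qed.

End Cauchy_kernel.
End RationalApproximation.

(** * Runge's theorem on a square grid *)

Section Runge.
Context {R : realType}.
Implicit Types (K U : set CC[R]) (f : CC[R] -> CC[R]) (z w t : CC[R]) (a b c d x y e : R).

Lemma compact_thickening K U : compact K -> open U -> K `<=` U ->
  exists2 d : R, 0 < d & forall z, K z -> forall t, normc (t - z) < d -> U t.
Proof.
move=> cK oU KU; apply: (compact_uniform (P := fun d z => forall t, normc (t - z) < d -> U t)
  cK).
  by move=> d d' z dd h t tz; apply: h; exact: lt_le_trans tz dd.
move=> z /KU Uz; have /nbhs_normcP[d d0 hd] : nbhs z U by apply: open_nbhs_nbhs.
exists (d / 2); first by rewrite divr_gt0.
apply/nbhs_normcP; exists (d / 2); first by rewrite divr_gt0.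
move=> w wz t tw; apply: hd; apply: le_lt_trans (ler_normc_dist _ w _) _.
by rewrite [d]splitr ltrD.
Qed.

(** Summation by parts; it turns sums over squares into sums over edges, in which an edge shared by
    two squares of equal coefficient disappears. *)
Lemma abel_sum (c H : nat -> CC[R]) N : c 0%N = 0 -> c N = 0 ->
  \sum_(j < N) c j * (H j - H j.+1) = \sum_(j < N) (c j.+1 - c j) * H j.+1.
Proof.
move=> c0 cN; apply/eqP; rewrite -subr_eq0 -sumrB; apply/eqP.
rewrite (eq_bigr (fun j : 'I_N => - (c j.+1 * H j.+1 - c j * H j))); last first.
  by move=> j _; ring.
rewrite sumrN -(big_mkord xpredT (fun j => c j.+1 * H j.+1 - c j * H j)).
by rewrite telescope_sumr// c0 cN !mul0r subrr oppr0.
Qed.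

Section Grid.
Variables (K U : set CC[R]) (f : CC[R] -> CC[R]) (X : nat -> R) (N : nat).
Hypothesis cK : compact K.
Hypothesis df : forall t, U t -> derivable f t 1.
Hypothesis XS : forall i, X i < X i.+1.

Let sq i j z := in_rect (X i) (X i.+1) (X j) (X j.+1) z.

Hypothesis sqU : forall i j z t, K z -> sq i j z -> sq i j t -> U t.
(** The lower bound is [X 1] rather than [X 0]: row and column 0 then miss K, as do those of index
    [N], which gives the vanishing end coefficients of [abel_sum]. *)
Hypothesis K_in_grid : forall z, K z ->
  X 1%N < complex.Re z < X N /\ X 1%N < complex.Im z < X N.

Let chi i j : CC[R] := `[< exists2 z, K z & sq i j z >]%:R.

Let hedge i j w := cint (fun x => f (x +i* X j)%C / ((x +i* X j)%C - w)) (X i) (X i.+1).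
Let vedge i j w := cint (fun y => f (X i +i* y)%C / ((X i +i* y)%C - w)) (X j) (X j.+1).

(* The Abel-summed form of the sum, over the squares that meet K, of the
   boundary integrals of f t / (t - w); an edge with nonzero coefficient lies in
   one square that meets K and in one that does not, hence in U but off K. *)
Let edges w : CC[R] :=
  \sum_(i < N) \sum_(j < N) (chi i j.+1 - chi i j) * hedge i j.+1 w
  - 'i%C * \sum_(j < N) \sum_(i < N) (chi i.+1 j - chi i j) * vedge i.+1 j w.

Let Xm i j : (i <= j)%N -> X i <= X j.
Proof.
by move=> /subnKC <-; elim: (j - i)%N => [|k IH]; rewrite ?addn0// addnS (le_trans IH)// ltW.
Qed.

Let chi0 i j : [\/ i = 0%N, i = N, j = 0%N | j = N] -> chi i j = 0.
Proof.
move=> h; rewrite /chi; case: asboolP => // -[z Kz [/andP[x1 x2] /andP[y1 y2]]].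
have [/andP[p1 p2] /andP[p3 p4]] := K_in_grid Kz.
case: h => h; rewrite h in x1 x2 y1 y2 *.
- by move: (le_lt_trans x2 p1); rewrite ltxx.
- by move: (le_lt_trans x1 p2); rewrite ltxx.
- by move: (le_lt_trans y2 p3); rewrite ltxx.
- by move: (le_lt_trans y1 p4); rewrite ltxx.
Qed.

Lemma edges_rectint w : edges w =
  \sum_(i < N) \sum_(j < N) chi i j *
     rectint (fun t => f t / (t - w)) (X i) (X i.+1) (X j) (X j.+1).
Proof.
rewrite /edges.
transitivity (\sum_(i < N) \sum_(j < N) chi i j * (hedge i j w - hedge i j.+1 w)
   - 'i%C * \sum_(j < N) \sum_(i < N) chi i j * (vedge i j w - vedge i.+1 j w)).
  congr (_ - _ * _); apply: eq_bigr => k _.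
    rewrite (@abel_sum (chi k) (fun j => hedge k j w))//; apply: chi0.
      exact: Or43.
    exact: Or44.
  rewrite (@abel_sum (chi^~ k) (fun i => vedge i k w))//; apply: chi0.
    exact: Or41.
  exact: Or42.
rewrite [X in _ - _ * X]exchange_big mulr_sumr -sumrB; apply: eq_bigr => i _.
rewrite mulr_sumr -sumrB; apply: eq_bigr => j _.
by rewrite /rectint -/(hedge i j w) -/(hedge i j.+1 w) -/(vedge i j w)
  -/(vedge i.+1 j w); ring.
Qed.

(** Cauchy's formula holds in the square containing w, and Goursat's lemma kills the other squares
    that meet K. The point z only certifies that the square of w meets K; w itself may lie off K. *)
Lemma edges_offgrid w z (i0 j0 : 'I_N) : K z -> sq i0 j0 z ->
  X i0 < complex.Re w < X i0.+1 -> X j0 < complex.Im w < X j0.+1 ->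
  edges w = 2 * pi%:C%C * 'i%C * f w.
Proof.
move=> Kz sz xw yw; rewrite edges_rectint.
have zero (i j : 'I_N) : (i != i0) || (j != j0) ->
    chi i j * rectint (fun t => f t / (t - w)) (X i) (X i.+1) (X j) (X j.+1) = 0.
  move=> ij; rewrite /chi; case: asboolP => [[z1 Kz1 sz1]|_]; last by rewrite mul0r.
  rewrite mul1r; apply: goursat; [exact/ltW/XS|exact/ltW/XS|].
  move=> t st; apply: derivable_div; last by apply: df; exact: sqU Kz1 sz1 st.
  have disj (k k0 : 'I_N) (u : R) : k != k0 -> X k0 < u < X k0.+1 -> ~~ (X k <= u <= X k.+1).
    move=> kk /andP[u1 u2]; apply/negP => /andP[v1 v2].
    have [lt|gt|/val_inj e] := ltngtP k k0; last by rewrite e eqxx in kk.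
      by have := le_lt_trans (le_trans v2 (Xm lt)) u1; rewrite ltxx.
    by have := lt_le_trans u2 (le_trans (Xm gt) v1); rewrite ltxx.
  apply/eqP => tw; move: st; rewrite tw => -[h1 h2]; case/orP: ij => [h|h].
    by move/negP: (disj _ _ _ h xw).
  by move/negP: (disj _ _ _ h yw).
rewrite (bigD1 i0)//= [X in _ + X]big1 ?addr0; last first.
  by move=> i ii; rewrite big1// => j _; rewrite zero// ii.
rewrite (bigD1 j0)//= [X in _ + X]big1 ?addr0; last first.
  by move=> j jj; rewrite zero// jj orbT.
have -> : chi i0 j0 = 1 by rewrite /chi; case: asboolP => // -[]; exists z.
rewrite mul1r; apply: cauchy_rect => // t st; apply: df; exact: sqU Kz sz st.
Qed.

Let edge_good i j (S : set CC[R]) i' j' : chi i j - chi i' j' != 0 ->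
  (forall t, S t -> sq i j t /\ sq i' j' t) -> forall t, S t -> ~ K t /\ U t.
Proof.
move=> c0 hS t /hS[s1 s2]; move: c0; rewrite /chi.
case: asboolP => [[z1 Kz1 sz1]|h1]; case: asboolP => [[z2 Kz2 sz2]|h2];
  rewrite ?subrr ?eqxx// => _; split.
- by move=> Kt; apply: h2; exists t.
- exact: sqU Kz1 sz1 s1.
- by move=> Kt; apply: h1; exists t.
- exact: sqU Kz2 sz2 s2.
Qed.

Let hedge_good i j : chi i j.+1 - chi i j != 0 ->
  forall x, X i <= x <= X i.+1 -> ~ K (x +i* X j.+1)%C /\ U (x +i* X j.+1)%C.
Proof.
move=> c0 x xi; apply: (edge_good (S := [set t | X i <= complex.Re t <= X i.+1 /\
  complex.Im t = X j.+1]) c0) => // t [/= h1 h2].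
by split; split => //; rewrite h2 lexx ltW.
Qed.

Let vedge_good i j : chi i.+1 j - chi i j != 0 ->
  forall y, X j <= y <= X j.+1 -> ~ K (X i.+1 +i* y)%C /\ U (X i.+1 +i* y)%C.
Proof.
move=> c0 y yi; apply: (edge_good (S := [set t | X j <= complex.Im t <= X j.+1 /\
  complex.Re t = X i.+1]) c0) => // t [/= h1 h2].
by split; split => //; rewrite h2 lexx ltW.
Qed.

Let hline y : forall a b, continuous_itv (fun x => (x +i* y)%C : CC[R]) a b.
Proof.
by move=> a b x _; apply: (@cvg_ReIm _ _ (nbhs x)); [exact: cvg_id|exact: cvg_cst].
Qed.

Let vline x : forall a b, continuous_itv (fun y => (x +i* y)%C : CC[R]) a b.
Proof.
by move=> a b y _; apply: (@cvg_ReIm _ _ (nbhs y)); [exact: cvg_cst|exact: cvg_id].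
Qed.

Let cfh i j : chi i j.+1 - chi i j != 0 ->
  continuous_itv (fun x => f (x +i* X j.+1)%C) (X i) (X i.+1).
Proof.
move=> c0; apply: continuous_hseg => x /(hedge_good c0)[_ Ux].
exact: derivable_continuous (df Ux).
Qed.

Let cfv i j : chi i.+1 j - chi i j != 0 ->
  continuous_itv (fun y => f (X i.+1 +i* y)%C) (X j) (X j.+1).
Proof.
move=> c0; apply: continuous_vseg => x /(vedge_good c0)[_ Ux].
exact: derivable_continuous (df Ux).
Qed.

Lemma edges_rapprox : rapprox K edges.
Proof.
rewrite /edges; apply: rapproxD.
  apply: rapprox_sum => i; apply: rapprox_sum => j.
  (* Such an edge may cross K or leave U, where its integral is uncontrolled; only the zero
     coefficient removes it. *)
  have [->|c0] := eqVneq (chi i j.+1 - chi i j) 0.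
    by apply: eq_rapprox (rapprox0 K) => z _; rewrite mul0r.
  apply: rapproxZ; have hK x : X i <= x <= X i.+1 -> ~ K (x +i* X j.+1)%C.
    by move=> /(hedge_good c0)[].
  have Q := rapprox_cint (cfh c0) (@hline (X j.+1) (X i) (X i.+1)) (ltW (XS i)) cK hK.
  exact: Q.
apply: (@eq_rapprox _ _ (fun z => (- 'i%C) *
   \sum_(j < N) \sum_(i < N) (chi i.+1 j - chi i j) * vedge i.+1 j z)).
  by move=> z _; rewrite mulNr.
apply: rapproxZ; apply: rapprox_sum => j; apply: rapprox_sum => i.
have [->|c0] := eqVneq (chi i.+1 j - chi i j) 0.
  by apply: eq_rapprox (rapprox0 K) => z _; rewrite mul0r.
apply: rapproxZ; have vK y : X j <= y <= X j.+1 -> ~ K (X i.+1 +i* y)%C.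
  by move=> /(vedge_good c0)[].
exact: (rapprox_cint (cfv c0) (@vline (X i.+1) (X j) (X j.+1)) (ltW (XS j)) cK vK).
Qed.

Lemma edges_continuous z : K z -> {for z, continuous edges}.
Proof.
move=> Kz; apply: ctsD; last apply: ctsN.
  apply: cts_sum => i; apply: cts_sum => j.
  have [c0|c0] := eqVneq (chi i j.+1 - chi i j) 0.
    rewrite (_ : (fun z => _) = fun=> 0); first exact: cts_cst.
    by apply/funext => w; rewrite c0 mul0r.
  apply: (ctsM (f := fun=> _)); first exact: cts_cst.
  have hz x : X i <= x <= X i.+1 -> (x +i* X j.+1)%C != z.
    by move=> /(hedge_good c0)[h _]; apply: contra_notN h => /eqP ->.
  exact: (cauchy_integral_continuous (cfh c0) (@hline (X j.+1) (X i) (X i.+1)) (ltW (XS i))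
    hz).
apply: (ctsM (f := fun=> _)); first exact: cts_cst.
apply: cts_sum => j; apply: cts_sum => i.
have [c0|c0] := eqVneq (chi i.+1 j - chi i j) 0.
  rewrite (_ : (fun z => _) = fun=> 0); first exact: cts_cst.
  by apply/funext => w; rewrite c0 mul0r.
apply: (ctsM (f := fun=> _)); first exact: cts_cst.
have vz y : X j <= y <= X j.+1 -> (X i.+1 +i* y)%C != z.
  by move=> /(vedge_good c0)[h _]; apply: contra_notN h => /eqP ->.
exact: (cauchy_integral_continuous (cfv c0) (@vline (X i.+1) (X j) (X j.+1)) (ltW (XS j)) vz).
Qed.

Let locate (u : R) n : X 0%N <= u -> u < X n -> exists2 i : 'I_n, X i <= u & u < X i.+1.
Proof.
move=> u0; elim: n => [|n IH] un; first by move: (le_lt_trans u0 un); rewrite ltxx.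
have [/IH[i h1 h2]|nu] := ltP u (X n); last by exists ord_max.
by exists (widen_ord (leqnSn n) i).
Qed.

(* Off the grid lines the formula is Cauchy's; a point of K on a grid line is a
   limit of off-grid points inside a square meeting K. *)
Lemma edges_on_K z : K z -> edges z = 2 * pi%:C%C * 'i%C * f z.
Proof.
move=> Kz; have [/andP[p1 p2] /andP[p3 p4]] := K_in_grid Kz.
have [i i1 i2] := locate (ltW (lt_trans (XS 0) p1)) p2.
have [j j1 j2] := locate (ltW (lt_trans (XS 0) p3)) p4.
have sz : sq i j z by split; rewrite ?i1 ?j1 ltW.
have Uz := sqU Kz sz sz.
pose D w : CC[R] := edges w + - (2 * pi%:C%C * 'i%C * f w).
have cD : {for z, continuous D}.
  apply: ctsD; first exact: edges_continuous.
  apply: ctsN; apply: (ctsM (f := fun=> _)); first exact: cts_cst.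
  exact: derivable_continuous (df Uz).
apply/eqP; rewrite -subr_eq0 -normc_eq0 -/(D z); apply/negPn/negP => n0.
have e0 : 0 < normc (D z) by rewrite lt_neqAle eq_sym n0 normc_ge0.
have [d d0 hd] := (cts_normcP D z).1 cD _ e0.
(* A diagonal shift by a quarter of the minimum stays strictly inside the square, off its lower and
   left sides too, and moves z by at most 2r < d. *)
pose r := Num.min (Num.min (X i.+1 - complex.Re z) (X j.+1 - complex.Im z)) d / 4.
have m0 : 0 < Num.min (Num.min (X i.+1 - complex.Re z) (X j.+1 - complex.Im z)) d.
  by rewrite !lt_min !subr_gt0 i2 j2.
have r0 : 0 < r by rewrite divr_gt0.
have r1 : r < Num.min (Num.min (X i.+1 - complex.Re z) (X j.+1 - complex.Im z)) d / 2.
  by rewrite ltr_pM2l// ltf_pV2 ?posrE// ltr_nat.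
have mx : Num.min (Num.min (X i.+1 - complex.Re z) (X j.+1 - complex.Im z)) d
    <= X i.+1 - complex.Re z by rewrite !ge_min lexx.
have my : Num.min (Num.min (X i.+1 - complex.Re z) (X j.+1 - complex.Im z)) d
    <= X j.+1 - complex.Im z by rewrite !ge_min lexx ?orbT.
have md : Num.min (Num.min (X i.+1 - complex.Re z) (X j.+1 - complex.Im z)) d
    <= d by rewrite !ge_min lexx ?orbT.
move: m0 r1 mx my md; set m := Num.min _ d => m0 r1 mx my md.
have rm : r < m by apply: lt_trans r1 _; rewrite ltr_pdivrMr// ltr_pMr// ltr1n.
pose w : CC[R] := z + (r +i* r)%C.
have D0 : D w = 0.
  rewrite /D (edges_offgrid Kz sz) ?addrN// /w raddfD /=; apply/andP; split.
  - by rewrite (le_lt_trans i1)// ltrDl.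
  - by rewrite -ltrBrDl (lt_le_trans rm).
  - by rewrite (le_lt_trans j1)// ltrDl.
  - by rewrite -ltrBrDl (lt_le_trans rm).
have : normc (D w - D z) < normc (D z).
  apply: hd; rewrite /w addrAC subrr add0r; apply: le_lt_trans (normc_le_ReIm _) _.
  rewrite /= gtr0_norm//; apply: lt_le_trans md.
  by rewrite [m]splitr ltrD.
by rewrite D0 sub0r normcN ltxx.
Qed.

Lemma grid_rapprox : rapprox K f.
Proof.
apply: (eq_rapprox _ (rapproxZ (2 * pi%:C%C * 'i%C)^-1 edges_rapprox)) => z Kz.
by rewrite edges_on_K// mulKf// twopii_neq0.
Qed.

End Grid.

Lemma runge K U f : compact K -> open U -> K `<=` U ->
  (forall t, U t -> derivable f t 1) -> (exists B : R, forall z, K z -> normc z <= B) ->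
  rapprox K f.
Proof.
move=> cK oU KU df [B hB]; have [d d0 hd] := compact_thickening cK oU KU.
pose L := `|B| + 1; have L0 : 0 < L by rewrite ltr_wpDl.
have d2 : 0 < 2 / d + 1 by rewrite ltr_wpDl// divr_ge0// ltW.
(* This makes h(2/d + 1) < 1, hence both h < 1, which keeps the border squares off K since L exceeds
   |B| by 1, and 2h < d, which keeps every square meeting K inside U. *)
pose N := (Num.truncn (2 * L * (2 / d + 1))).+1.
have N0 : (0 : R) < N%:R by rewrite ltr0n.
pose h := 2 * L / N%:R; have h0 : 0 < h by rewrite divr_gt0// mulr_gt0.
have hs : h * (2 / d + 1) < 1.
  by rewrite /h mulrAC ltr_pdivrMr// mul1r truncnS_gt.
have h1 : h < 1.
  by apply: le_lt_trans hs; apply: (ler_peMr (ltW h0)); rewrite lerDr divr_ge0// ltW.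
have hd2 : 2 * h < d.
  have : h * (2 / d) < 1 by apply: le_lt_trans hs; rewrite ler_pM2l// lerDl.
  by rewrite mulrA ltr_pdivrMr// mul1r mulrC.
pose X (i : nat) := - L + i%:R * h.
have XSE i : X i.+1 = X i + h by rewrite /X -natr1; ring.
have XN : X N = L by rewrite /X /h mulrCA mulfV ?gt_eqF//; ring.
have XS i : X i < X i.+1 by rewrite XSE ltrDl.
have bnd (u : R) z : K z -> `|u| <= normc z -> X 1%N < u < X N.
  move=> Kz uz; have : `|u| <= `|B|.
    by rewrite (le_trans uz)// (le_trans (hB z Kz))// ler_norm.
  rewrite ler_norml => /andP[u1 u2]; rewrite XN /X mul1r; apply/andP; split.
    by apply: lt_le_trans u1; rewrite /L opprD -addrA gtrDl addrC subr_lt0.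
  by rewrite (le_lt_trans u2)// ltrDl.
apply: (@grid_rapprox K U f X N cK df XS).
  move=> i j z t Kz [/andP[x1 x2] /andP[y1 y2]] [/andP[x3 x4] /andP[y3 y4]].
  apply: (hd z Kz); apply: le_lt_trans (normc_le_ReIm _) _; rewrite !raddfB /=.
  apply: le_lt_trans hd2; rewrite mulr_natl mulr2n; apply: lerD.
    by rewrite XSE in x2 x4; rewrite ler_norml; apply/andP; split; clear -x1 x2 x3 x4; lra.
  by rewrite XSE in y2 y4; rewrite ler_norml; apply/andP; split; clear -y1 y2 y3 y4; lra.
by move=> z Kz; split; apply: (bnd _ z Kz); [exact: ler_normc_Re|exact: ler_normc_Im].
Qed.

End Runge.

(** * Residues on a Jordan domain *)

Section Residues.
Context {R : realType}.
Implicit Types (g : R -> CC[R]) (f h F W : CC[R] -> CC[R]) (a z t : CC[R])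
  (Omega : set CC[R]) (e : R).

Lemma trace_curve g x : 0 <= x <= 1 -> trace g (g x).
Proof. by move=> x01; exists x => //=; rewrite in_itv. Qed.

Lemma eq_is_contour_integral g f h J : (forall z, trace g z -> f z = h z) ->
  is_contour_integral g f J -> is_contour_integral g h J.
Proof.
move=> fh If e /If[d d0 hd]; exists d => // s t p m.
have -> : riemann_stieltjes_sum g h s t = riemann_stieltjes_sum g f s t.
  apply: eq_bigr => i _; rewrite fh//; apply/trace_curve.
  exact: tagged_partition_tag p (ltn_ord i).
exact: hd.
Qed.

Lemma is_contour_integral_le g h J (B : R) : rectifiable g ->
  (forall z, trace g z -> normc (h z) <= B) -> is_contour_integral g h J ->
  normc J <= B * curve_length g.
Proof.
move=> rg hB Ih; apply/ler_addgt0Pr => e e0; have [d d0 hd] := Ih e e0.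
have [s [t [p m]]] := tagged_partition_exists d0.
have h1 := riemann_stieltjes_sum_le rg p hB; have h2 := hd s t p m.
have := lerB_normc J (riemann_stieltjes_sum g h s t).
rewrite (normcB J) lerBlDr => /le_trans; apply; rewrite addrC lerD// ltW//.
Qed.

(** Integrability of F is part of the conclusion: its sums differ from those of h by at most C e
    times the length, for every tagged partition. The three terms of [D] pay for this, for the shift
    of the integral and for the mesh error. *)
Lemma is_contour_integral_approx g F J (C : R) : rectifiable g -> 0 <= C ->
  (forall e, 0 < e -> exists h K, [/\ is_contour_integral g h K,
     forall z, trace g z -> normc (F z - h z) <= C * e & normc (K - J) <= C * e]) ->
  is_contour_integral g F J.
Proof.
move=> rg C0 H e e0; have l0 := curve_length_ge0 rg.
pose D := C * curve_length g + C + 1.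
have D0 : 0 < D by rewrite ltr_wpDl// addr_ge0// mulr_ge0.
have [h [K [IK Fh KJ]]] := H _ (divr_gt0 e0 D0).
have [d d0 hd] := IK _ (divr_gt0 e0 D0); exists d => // s t p m.
have h1 := hd s t p m; have h2 := riemann_stieltjes_sum_le rg p Fh.
have -> : riemann_stieltjes_sum g F s t - J =
    riemann_stieltjes_sum g (fun z => F z - h z) s t +
    (riemann_stieltjes_sum g h s t - K) + (K - J).
  have -> : riemann_stieltjes_sum g (fun z => F z - h z) s t =
      riemann_stieltjes_sum g F s t - riemann_stieltjes_sum g h s t.
    by rewrite /riemann_stieltjes_sum -sumrB; apply: eq_bigr => i _; rewrite mulrBl.
  ring.
have -> : e = (C * (e / D)) * curve_length g + e / D + C * (e / D).
  by rewrite /D; field; rewrite gt_eqF.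
apply: le_lt_trans (le_normcD _ _) _; apply: ltr_leD => //.
by apply: le_lt_trans (le_normcD _ _) _; apply: ler_ltD.
Qed.

Section JordanDomain.
Variables (g : R -> CC[R]) (Omega : set CC[R]).
Hypotheses (bO : bounded_domain Omega) (jg : jordan_curve g) (rg : rectifiable g).
Hypotheses (tg : trace g = boundary Omega) (po : positively_oriented g Omega).

Let trace_closure z : trace g z -> closure Omega z.
Proof. by rewrite tg => -[]. Qed.

Lemma cauchy_theorem F : rapprox (closure Omega) F -> is_contour_integral g F 0.
Proof.
move=> rF; apply: (@is_contour_integral_approx g F 0 1) => // e e0.
have [s sK hs] := rF e e0; exists (simple_fractions s), 0; split.
- elim: s sK {hs} => [|q s IH] sK.
    apply: eq_is_contour_integral (is_contour_integral0 g) => z _.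
    by rewrite /simple_fractions big_nil.
  have qK : ~ closure Omega q.2 by apply: sK; rewrite inE eqxx.
  have := is_contour_integralZ (- q.1) (contour_integral_outside bO jg rg tg po qK).
  have := IH (fun r rs => sK r (mem_behead (s := q :: s) rs)).
  move=> /is_contour_integralD h /h; rewrite mulr0 addr0.
  apply: eq_is_contour_integral => z _; rewrite /simple_fractions big_cons addrC.
  by congr (_ + _); rewrite -(opprB z) invrN mulrN mulNr.
- by move=> z /trace_closure /hs; rewrite mul1r.
- by rewrite subr0 normc0 mulr_ge0// ltW.
Qed.

(** For a fraction with pole q outside, 1/((q - z)(z - a)) = (1/(z - a) - 1/(z - q))/(q - a): the
    first part winds once, the second not at all. *)
Lemma cauchy_integral_formula F a : rapprox (closure Omega) F -> Omega a ->
  is_contour_integral g (fun z => F z / (z - a)) (2 * pi%:C%C * 'i%C * F a).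
Proof.
move=> rF Oa; have [oO _ _ _] := bO.
have [m m0 hm] : exists2 m : R, 0 < m & forall z, trace g z -> m <= normc (z - a).
  have : nbhs a Omega by apply: open_nbhs_nbhs.
  move=> /nbhs_normcP[m m0 hm]; exists m => // z tz; rewrite leNgt; apply/negP => za.
  exact: interior_point_notin_trace oO tg (hm _ za) tz.
have za z : trace g z -> z - a != 0.
  by move=> /hm; rewrite -normc_gt0; apply: lt_le_trans.
(* The first summand bounds 1/|z - a| on the curve, the second the factor 2 pi i on the values at
   a. *)
pose C := m^-1 + normc (2 * pi%:C%C * 'i%C : R[i]).
have C0 : 0 <= C by rewrite addr_ge0 ?normc_ge0// invr_ge0 ltW.
apply: (@is_contour_integral_approx _ _ _ C) => // e e0.
have [s sK hs] := rF e e0.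
exists (fun z => simple_fractions s z / (z - a)), (2 * pi%:C%C * 'i%C * simple_fractions s a).
split.
- elim: s sK {hs} => [|q s IH] sK.
    rewrite /simple_fractions big_nil mulr0.
    apply: eq_is_contour_integral (is_contour_integral0 g) => z _.
    by rewrite big_nil mul0r.
  have qK : ~ closure Omega q.2 by apply: sK; rewrite inE eqxx.
  have qa : q.2 - a != 0.
    by rewrite subr_eq0; apply: contra_notN qK => /eqP ->; exact: subset_closure.
  have i1 := contour_integral_inside bO jg rg tg po Oa.
  have i2 := is_contour_integralZ (- 1) (contour_integral_outside bO jg rg tg po qK).
  have i3 := is_contour_integralZ (q.1 / (q.2 - a)) (is_contour_integralD i1 i2).
  have i4 := is_contour_integralD i3 (IH (fun r rs => sK r (mem_behead (s := q :: s) rs))).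
  rewrite mulr0 addr0 in i4.
  have -> : 2 * pi%:C%C * 'i%C * simple_fractions (q :: s) a =
      q.1 / (q.2 - a) * (2 * pi%:C%C * 'i%C) + 2 * pi%:C%C * 'i%C * simple_fractions s a.
    by rewrite /simple_fractions big_cons mulrDr [X in X + _]mulrC.
  apply: eq_is_contour_integral i4 => z tz; rewrite /simple_fractions big_cons mulrDl.
  congr (_ + _); have zq : z - q.2 != 0.
    by rewrite subr_eq0; apply: contra_notN qK => /eqP <-; exact: trace_closure.
  have zq' : q.2 - z != 0 by rewrite -opprB oppr_eq0.
  by field; rewrite qa zq' za// zq.
- move=> z tz; rewrite -mulrBl normcM normcV.
  apply: (@le_trans _ _ (e * m^-1)).
    apply: ler_pM; rewrite ?invr_ge0 ?normc_ge0//; first by apply: hs; exact: trace_closure.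
    by rewrite lef_pV2 ?posrE ?hm// normc_gt0 za.
  by rewrite mulrC; apply: ler_wpM2r; [exact: ltW|rewrite /C lerDl normc_ge0].
- rewrite -mulrBr normcM; apply: ler_pM; rewrite ?normc_ge0//.
    by rewrite /C lerDr invr_ge0 ltW.
  by rewrite normcB; apply: hs; exact: subset_closure.
Qed.

End JordanDomain.

Lemma derivable_horner_complex (p : {poly R[i]}) t :
  derivable (fun x : CC[R] => p.[x] : CC[R]) t 1.
Proof.
elim/poly_ind: p => [|p c IH].
  rewrite (_ : (fun x => _) = fun=> 0); first exact: derivable_cst.
  by apply/funext => x; rewrite horner0.
rewrite (_ : (fun x => _) = fun x : CC[R] => p.[x] * x + c).
  have dM := @derivableM R[i] CC[R] (fun x : CC[R] => p.[x]) id t 1 IH (@derivable_id _ _ _ _).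
  exact: (@derivableD R[i] CC[R] CC[R] _ (fun=> c) t 1 dM (@derivable_cst _ _ _ _ _ _)).
by apply/funext => x; rewrite hornerMXaddC.
Qed.

Lemma derivable_bigsum (I : Type) (r : seq I) (P : pred I) (F : I -> CC[R] -> CC[R]) t :
  (forall i, P i -> derivable (F i) t 1) ->
  derivable (fun x => \sum_(i <- r | P i) F i x : CC[R]) t 1.
Proof.
move=> dF; elim: r => [|i r IH].
  rewrite (_ : (fun x => _) = fun=> 0); first exact: derivable_cst.
  by apply/funext => x; rewrite big_nil.
case Pi : (P i).
  rewrite (_ : (fun x => _) = fun x => F i x + \sum_(i <- r | P i) F i x).
    exact: (@derivableD R[i] CC[R] CC[R] _ _ t 1 (dF i Pi) IH).
  by apply/funext => x; rewrite big_cons Pi.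
rewrite (_ : (fun x => _) = fun x => \sum_(i <- r | P i) F i x) //.
by apply/funext => x; rewrite big_cons Pi.
Qed.

End Residues.

(** * The quadrature rule and its error *)

Section RationalQuadrature.
Context {R : realType}.
Implicit Types (f rho : CC[R] -> CC[R]) (Omega : set CC[R]).

Lemma contour_integral_rational (Omega : set CC[R]) (g : R -> CC[R]) f n
    (z c d : 'I_n -> CC[R]) (p : {poly R[i]}) :
  bounded_domain Omega -> jordan_curve g -> rectifiable g -> trace g = boundary Omega ->
  positively_oriented g Omega -> analytic_near (closure Omega) f ->
  (forall k, ~ boundary Omega (z k)) ->
  is_contour_integral g
    (fun x => f x * (\sum_(k < n | z k \in Omega) c k / (x - z k)
                   + \sum_(k < n | z k \notin Omega) d k / (x - z k) + p.[x]))
    (2 * pi%:C%C * 'i%C * \sum_(k < n | z k \in Omega) c k * f (z k)).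
Proof.
move=> bO jg rg tg po [U [oU KU df]] zb; have [oO _ _ bdO] := bO.
have [B hB] := bounded_set_normc bdO.
have hK x : closure Omega x -> normc x <= B + 1.
  move=> /(_ [set y : CC[R] | normc (y - x) < 1])[|y [Oy /= yx]].
    by apply/nbhs_normcP; exists 1.
  have := lerB_normc x y; rewrite (normcB x); have := hB y Oy; lra.
have cK : compact (closure Omega).
  by apply: compact_closed_bounded; [exact: closed_closure|exists (B + 1)].
have rf : rapprox (closure Omega) f by apply: (runge cK oU KU df); exists (B + 1).
have zout k : z k \notin Omega -> ~ closure Omega (z k).
  by move=> /negP kO kc; apply: (zb k); split => //; rewrite (interior_id _).1// => /mem_set.
pose F x : CC[R] := f x * (\sum_(k < n | z k \notin Omega) d k / (x - z k) + p.[x]).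
pose P : set CC[R] := [set z k | k in [set k | z k \notin Omega]].
(* The outside poles form a finite, hence closed, set disjoint from the closure of [Omega]; [F] is
   analytic on what remains of [U]. *)
have oP : open (U `&` ~` P).
  apply: openI => //; rewrite openC.
  apply: (accessible_finite_set_closed.1 (hausdorff_accessible (@norm_hausdorff R[i] CC[R]))).
  exact: finite_image.
have rF : rapprox (closure Omega) F.
  apply: (runge cK oP _ _ (ex_intro _ (B + 1) hK)).
    by move=> x Kx; split; [exact: KU|move=> [k /= kO kx]; apply: (zout k kO); rewrite kx].
  move=> t [Ut Pt].
  have dS : derivable (fun x : CC[R] => \sum_(k < n | z k \notin Omega) d k / (x - z k) :
    CC[R]) t 1.
    apply: derivable_bigsum => k kO.
    apply: (@derivable_div R (fun=> d k) (z k) t); last exact: derivable_cst.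
    by apply: contra_notN Pt => /eqP ->; exists k.
  have dD := @derivableD R[i] CC[R] CC[R] _ _ t 1 dS (@derivable_horner_complex R p t).
  exact: (@derivableM R[i] CC[R] f _ t 1 (df t Ut) dD).
have i1 := cauchy_theorem bO jg rg tg po rF.
(* The value 0 at outside indices allows a sum over all of 'I_n, since Cauchy's formula is available
   for inside poles only. *)
pose H k (x : CC[R]) : CC[R] := if z k \in Omega then c k * (f x / (x - z k)) else 0.
pose J k : CC[R] := if z k \in Omega then c k * (2 * pi%:C%C * 'i%C * f (z k)) else 0.
have i2 k : is_contour_integral g (H k) (J k).
  rewrite /H /J; case: ifPn => [/set_mem kO|_]; last exact: is_contour_integral0.
  exact: is_contour_integralZ (cauchy_integral_formula bO jg rg tg po rf kO).
have := is_contour_integralD (is_contour_integral_sum (index_enum 'I_n) i2) i1.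
rewrite addr0 (_ : \sum_(k <- _) J k = 2 * pi%:C%C * 'i%C * \sum_(k < n | z k \in Omega) c k *
  f (z k)).
  apply: eq_is_contour_integral => x _; rewrite /F -addrA [RHS]mulrDr; congr (_ + _).
  rewrite mulr_sumr [in RHS]big_mkcond; apply: eq_bigr => k _; rewrite /H; case: ifP => // _.
  by rewrite mulrCA.
rewrite mulr_sumr [in RHS]big_mkcond; apply: eq_bigr => k _; rewrite /J; case: ifP => // _.
by rewrite mulrCA.
Qed.

End RationalQuadrature.

Unset Implicit Arguments.

Theorem theorem2p1 (R : realType) (Omega : set CC[R]) (g : R -> CC[R])
    (f w W : CC[R] -> CC[R])
    (n : nat) (z c d : 'I_n -> CC[R]) (p : {poly R[i]})
    (rho : CC[R] -> CC[R]) (eps M : R) :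
  bounded_domain Omega ->
  jordan_curve g -> rectifiable g -> trace g = boundary Omega ->
  positively_oriented g Omega ->
  analytic_near (closure Omega) f ->
  dbar_antiderivative Omega W w ->
  area_integrable Omega (fun x => f x * w x) ->
  contour_integrable g (fun x => f x * W x) ->
  area_integral Omega (fun x => f x * w x) =
    (2 * 'i%C)^-1 * contour_integral g (fun x => f x * W x) ->
  injective z -> (forall k, ~ boundary Omega (z k)) ->
  (forall x, rho x = \sum_(k < n | z k \in Omega) c k / (x - z k)
                   + \sum_(k < n | z k \notin Omega) d k / (x - z k)
                   + p.[x]) ->
  is_max_on (boundary Omega) (fun x => normc (rho x - W x)) eps ->
  is_max_on (boundary Omega) (fun x => normc (f x)) M ->
  let I := area_integral Omega (fun x => f x * w x) in
  let I_n := pi%:C%C * \sum_(k < n | z k \in Omega) c k * f (z k) in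
  normc (I - I_n) <= 2^-1 * curve_length g * eps * M.
Proof.
move=> bO jg rg tg po af _ _ ciW green _ zb rhoE [_ heps] [_ hM]; cbv zeta.
set I := area_integral _ _; set I_n := pi%:C%C * _.
have irho := @contour_integral_rational R Omega g f n z c d p bO jg rg tg po af zb.
(* Integrability ensures that the value in Green's identity is a true limit and not the default
   0. *)
have iW : is_contour_integral g (fun x => f x * W x)
    (contour_integral g (fun x => f x * W x)) by exact: xgetPex ciW.
set S := \sum_(k < n | _) c k * _ in irho I_n *.
set J := contour_integral g _ in iW green.
have iD := is_contour_integralD iW (is_contour_integralZ (- 1) irho).
have i0 : 2 * 'i%C != 0 :> R[i].
  by rewrite mulf_neq0 ?pnatr_eq0// eq_complex /= oner_eq0 andbF.
(* Since 2 pi i/(2i) = pi, [I_n] is 1/(2i) times the contour integral of f rho; this is the origin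
   of the factor pi in the rule. *)
have -> : I - I_n = (2 * 'i%C)^-1 * (J + (- 1) * (2 * pi%:C%C * 'i%C * S)).
  rewrite /I green /I_n mulrDr; congr (_ + _); apply: (mulfI i0).
  by rewrite mulVKf//; ring.
have n2i : normc ((2 * 'i%C)^-1 : R[i]) = 2^-1.
  rewrite normcV normcM; congr (_^-1); rewrite -[2 in LHS](rmorph_nat (real_complex R)).
  by rewrite normc_real ger0_norm// /= expr0n expr1n add0r sqrtr1 mulr1.
have -> : 2^-1 * curve_length g * eps * M = 2^-1 * (M * eps * curve_length g) by ring.
rewrite normcM n2i ler_pM2l ?invr_gt0//.
apply: (is_contour_integral_le rg _ iD) => x; rewrite tg => bx.
rewrite (_ : _ + _ = f x * (W x - rho x)); last by rewrite rhoE; ring.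
by rewrite normcM normcB; apply: ler_pM; rewrite ?normc_ge0 ?hM ?heps.
Qed.
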